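(* Let $p,q,r$ be positive real numbers with $0<r<\frac1q$ and $p>\max\{1,\frac1q\}$, and let $\lambda>0$. If $v\in X$ is a weak solution of the problem $$\frac{d^2}{dx^2}\left(|v''|^{\frac1q-1}v''\right)=\lambda v_+^{r}+v_+^{p}\ \text{ in }(0,1),\qquad v(0)=v(1)=0,\quad v''(0)=v''(1)=0,$$ then $v$ is also a classical solution of this problem.
   Context: $t_+:=\max\{t,0\}$, and for $s>0$ the expression $|t|^{s-1}t$ is $0$ at $t=0$. $X:=W^{2,\frac{q+1}{q}}(0,1)\cap W_0^{1,\frac{q+1}{q}}(0,1)$. A weak solution is a function $v\in X$ such that for every $\varphi\in X$ $$\int_0^1|v''|^{\frac1q-1}v''\varphi''\,dx=\int_0^1\left(\lambda v_+^{r}+v_+^{p}\right)\varphi\,dx.$$ A classical solution is a function $v\in C^2[0,1]$ such that $|v''|^{\frac1q-1}v''\in C^2(0,1)$ and the equation and the boundary conditions are satisfied pointwise. (Elements of $X$ are identified with their continuous representatives, and $v''$ with a suitable representative of the weak derivative.) *)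

(* Defs.v *)
From HB Require Import structures.
From mathcomp Require Import all_boot all_order all_algebra.
From mathcomp Require Import all_classical all_reals all_analysis.

Set Implicit Arguments.
Unset Strict Implicit.
Unset Printing Implicit Defensive.

Import Order.TTheory GRing.Theory Num.Theory.
Import numFieldNormedType.Exports.

Local Open Scope ring_scope.
Local Open Scope classical_set_scope.

(* All functions are total, R -> R; only their values on the interval matter. *)

Section SobolevSpaces.
Context {R : realType}.
Implicit Types (m : R) (k : nat) (u g phi : R -> R).

Definition Lnorm01 m u : \bar R :=
  'N[@lebesgue_measure R]_(m%:E)[EFin \o (u \_ `]0, 1[)].

Definition Lfun01 m u : Prop :=
  u \_ `]0, 1[ \in Lfun (@lebesgue_measure R) m%:E.

(* The space C_c^oo(0,1). *)
Definition test_function phi : Prop :=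
  [/\ forall k x, derivable phi^`(k) x 1,
      compact (closure [set x | phi x != 0])
    & closure [set x | phi x != 0] `<=` `]0, 1[].

(* g represents the k-th weak derivative of u on (0,1) and lies in L^m(0,1);
   meant for u in L^m(0,1) with m >= 1, so that the integrands are integrable. *)
Definition weak_derivative m k u g : Prop :=
  Lfun01 m g /\
  forall phi, test_function phi ->
    \int[lebesgue_measure]_(x in `]0, 1[) (u x * (phi^`(k))%classic x) =
    (-1) ^+ k * \int[lebesgue_measure]_(x in `]0, 1[) (g x * phi x).

(* W^{k,m}(0,1) *)
Definition sobolev k m u : Prop :=
  Lfun01 m u /\
  forall j, (j <= k)%N -> exists g, weak_derivative m j u g.

(* W_0^{1,m}(0,1): the closure of C_c^oo(0,1) in W^{1,m}(0,1). *)
Definition sobolev0 m u : Prop :=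
  Lfun01 m u /\
  exists2 g, weak_derivative m 1 u g &
    forall e : R, 0 < e -> exists2 phi, test_function phi &
      (Lnorm01 m (u \- phi)%R + Lnorm01 m (g \- (phi^`())%classic)%R < e%:E)%E.

End SobolevSpaces.

Section ClassicalDerivatives.
Context {R : realType}.
Implicit Types (A : set R) (k : nat) (f g : R -> R).

(* One-sided at the endpoints when A is a closed interval. *)
Definition is_derivative_on A f g : Prop :=
  forall x, A x -> (f y - f x) / (y - x) @[y --> within A x^'] --> g x.

(* For A open. *)
Definition C_open k A f : Prop :=
  (forall j x, (j < k)%N -> A x -> derivable f^`(j) x 1) /\
  {in A, continuous f^`(k)}.

End ClassicalDerivatives.

Section Problem.
Context {R : realType}.
Implicit Types (lambda p q r s t : R) (u v : R -> R).

(* |t|^(s-1) t, which is 0 at t = 0 whatever the value of the power there *)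
Definition signed_pow s t : R := `|t| `^ (s - 1) * t.

(* lambda t_+^r + t_+^p *)
Definition rhs lambda p r t : R :=
  lambda * Num.max t 0 `^ r + Num.max t 0 `^ p.

(* An element of W^{2,(q+1)/q} /\ W_0^{1,(q+1)/q}, given by its continuous
   representative on [0,1]. *)
Definition X q u : Prop :=
  [/\ {within `[0, 1], continuous u},
      sobolev 2 ((q + 1) / q) u
    & sobolev0 ((q + 1) / q) u].

(* v2 and phi2 are representatives of v'' and phi''; the choice is immaterial. *)
Definition weak_solution lambda p q r v : Prop :=
  X q v /\
  exists2 v2, weak_derivative ((q + 1) / q) 2 v v2 &
    forall phi phi2, X q phi -> weak_derivative ((q + 1) / q) 2 phi phi2 ->
      \int[lebesgue_measure]_(x in `]0, 1[) (signed_pow q^-1 (v2 x) * phi2 x) =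
      \int[lebesgue_measure]_(x in `]0, 1[) (rhs lambda p r (v x) * phi x).

Definition classical_solution lambda p q r v : Prop :=
  exists v1 v2 : R -> R,
    [/\ is_derivative_on `[0, 1] v v1,
        is_derivative_on `[0, 1] v1 v2
      & {within `[0, 1], continuous v2}] /\
    [/\ C_open 2 `]0, 1[ (signed_pow q^-1 \o v2),
        forall x, x \in `]0, 1[ ->
          (signed_pow q^-1 \o v2)^`(2) x = rhs lambda p r (v x),
        v 0 = 0 /\ v 1 = 0
      & v2 0 = 0 /\ v2 1 = 0].

End Problem.

(* Main.v *)
Require Import Defs.
From mathcomp Require Import all_boot all_order all_algebra.
From mathcomp Require Import all_classical all_reals all_analysis.
From mathcomp Require Import measurable_realfun.
From mathcomp Require Import ring lra.

Set Implicit Arguments.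
Unset Strict Implicit.
Unset Printing Implicit Defensive.

Import Order.TTheory GRing.Theory Num.Theory.
Import numFieldNormedType.Exports.

Local Open Scope ring_scope.
Local Open Scope classical_set_scope.

(** The unknown function enters the weak equation only through
    w = |v''|^(1/q-1) v'' and through the right-hand side f = lambda v_+^r + v_+^p.
    Since v is continuous, so is f, and w is integrable because |w| = |v''|^(1/q)
    with 1/q below the exponent 1 + 1/q of the Sobolev space.

    Testing with phi in C_c^oo(0,1) says that w'' = f in the sense of
    distributions.  A double primitive F of f is a classical C^2 function with the
    same distributional second derivative, so w - F has vanishing weak second
    derivative, hence is affine almost everywhere ([ae_affine_test2],
    [ae_primitive2]).  Thus w agrees almost everywhere with a function W of
    class C^2 such that W'' = f.  As t |-> |t|^(1/q-1) t has the continuous inverse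
    t |-> |t|^(q-1) t, v'' agrees almost everywhere with the continuous function
    V2 = |W|^(q-1) W, and the same argument, now applied to v and V2, shows that
    v is C^2 on [0, 1] with second derivative V2 ([ae01_continuous_eq] upgrades
    almost everywhere to everywhere).  Moreover |V2|^(1/q-1) V2 = W is C^2.

    The boundary conditions come from two more integrations by parts.  That
    v(0) = v(1) = 0 follows from the approximation of v by test functions, for
    which no boundary term appears ([sobolev0_boundary]).  That W(0) = W(1) = 0,
    which is v''(0) = v''(1) = 0, follows by testing the equation with
    phi = x (1 - x) rho: its derivatives at 0 and 1 are rho(0) and - rho(1)
    ([natural_boundary]).  These functions are admissible because they are limits
    of test functions in W^(1,m) ([smooth_dirichlet_sobolev0]).

    Everything rests on a supply of test functions, all built from exp(-1/t)
    ([flat]); du Bois-Reymond's lemma is obtained from them by approximating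
    indicator functions ([ae_eq0_test]) and by noting that a test function of mean
    zero has a primitive that is a test function ([test_function_primitive],
    [functional_of_mean]). *)

(** * Calculus on the line and on the unit interval *)

Section Calculus.
Context {R : realType}.
Implicit Types (f g h u F G : R -> R) (a b c x y : R).

Local Notation mu := (@lebesgue_measure R).
Local Notation I01 := (`]0, 1[ : set R).

Definition has_deriv f g := forall x, is_derive x (1 : R) f (g x).

Lemma is_derive_subst f x a b :
  is_derive x (1 : R) f a -> a = b -> is_derive x (1 : R) f b.
Proof. by move=> + <-. Qed.

Lemma has_deriv_continuous f g : has_deriv f g -> continuous f.
Proof.
move=> fg x; apply: differentiable_continuous; apply/derivable1_diffP.
by have [] := fg x.
Qed.

Lemma has_derivE f g : has_deriv f g -> f^`() = g.
Proof. by move=> fg; apply/funext => x; rewrite derive1E; have [] := fg x. Qed.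

Lemma has_derivP f : (forall x, derivable f x 1) -> has_deriv f f^`().
Proof. by move=> df x; rewrite derive1E; exact: derivableP. Qed.

Lemma has_derivD f f' g g' : has_deriv f f' -> has_deriv g g' ->
  has_deriv (fun x => f x + g x) (fun x => f' x + g' x).
Proof. by move=> df dg x; have := df x; have := dg x => *; exact: is_deriveD. Qed.

Lemma has_derivN f f' : has_deriv f f' ->
  has_deriv (fun x => - f x) (fun x => - f' x).
Proof. by move=> df x; have := df x => *; exact: is_deriveN. Qed.

Lemma has_derivB f f' g g' : has_deriv f f' -> has_deriv g g' ->
  has_deriv (fun x => f x - g x) (fun x => f' x - g' x).
Proof. by move=> df dg; apply: has_derivD => //; exact: has_derivN. Qed.

Lemma has_derivM f f' g g' : has_deriv f f' -> has_deriv g g' ->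
  has_deriv (fun x => f x * g x) (fun x => f' x * g x + f x * g' x).
Proof.
move=> df dg x; have := df x; have := dg x => h1 h2.
have := @is_deriveM _ _ f g x 1 _ _ h2 h1.
by move/is_derive_subst; apply; rewrite addrC /GRing.scale/= [g x * _]mulrC.
Qed.

Lemma has_deriv_cst c : has_deriv (fun=> c) (fun=> 0).
Proof. by move=> x; exact: is_derive_cst. Qed.

Lemma has_deriv_id : has_deriv (fun x => x) (fun=> 1).
Proof. by move=> x; exact: is_derive_id. Qed.

Lemma has_derivZ c f f' : has_deriv f f' ->
  has_deriv (fun x => c * f x) (fun x => c * f' x).
Proof.
move=> df; have := has_derivM (has_deriv_cst c) df.
by congr has_deriv; apply/funext => x; rewrite mul0r add0r.
Qed.

Lemma has_deriv_affine f f' a b : has_deriv f f' ->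
  has_deriv (fun x => f (a * x + b)) (fun x => a * f' (a * x + b)).
Proof.
move=> df x.
have dl : is_derive x (1 : R) (fun x => a * x + b) a.
  have := has_derivD (has_derivZ a has_deriv_id) (has_deriv_cst b).
  by move=> /(_ x) /is_derive_subst; apply; rewrite mulr1 addr0.
have dfl := df (a * x + b).
have := @is_derive1_comp _ f (fun x => a * x + b) x _ _ dfl dl.
by move/is_derive_subst; apply; rewrite mulrC.
Qed.

Lemma has_deriv_derivable f g x : has_deriv f g -> derivable f x 1.
Proof. by move=> fg; have [] := fg x. Qed.

Lemma has_deriv_oo_LR f g a b : has_deriv f g -> derivable_oo_LRcontinuous f a b.
Proof.
move=> fg; have cf := has_deriv_continuous fg; split.
- by move=> x _; exact: has_deriv_derivable fg.
- exact/cvg_at_right_filter/cf.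
- exact/cvg_at_left_filter/cf.
Qed.

Lemma continuous_integrable_cc f a b :
  continuous f -> mu.-integrable `[a, b] (EFin \o f).
Proof.
move=> cf; apply: continuous_compact_integrable; first exact: segment_compact.
exact: continuous_subspaceT.
Qed.

Lemma continuous_integrable01 f : continuous f -> mu.-integrable I01 (EFin \o f).
Proof.
move=> cf; apply: integrableS (continuous_integrable_cc 0 1 cf) => //.
exact: subset_itv_oo_cc.
Qed.

Lemma Rintegral01_cc f : continuous f ->
  \int[mu]_(x in I01) f x = \int[mu]_(x in `[0, 1]) f x.
Proof.
move=> cf; rewrite Rintegral_itv_bndo_bndc; last exact: continuous_integrable01.
rewrite Rintegral_itv_obnd_cbnd//.
apply: integrableS (continuous_integrable_cc 0 1 cf) => //.
by apply: subset_itvr; rewrite bnd_simp.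
Qed.

Lemma integration_by_parts01 F f G g :
  has_deriv F f -> continuous f -> has_deriv G g -> continuous g ->
  \int[mu]_(x in I01) (F x * g x) =
  F 1 * G 1 - F 0 * G 0 - \int[mu]_(x in I01) (f x * G x).
Proof.
move=> dF cf dG cg.
have cF := has_deriv_continuous dF; have cG := has_deriv_continuous dG.
rewrite !Rintegral01_cc; first last.
- by move=> x; apply: continuousM; [exact: cF|exact: cg].
- by move=> x; apply: continuousM; [exact: cf|exact: cG].
rewrite (@Rintegration_by_parts _ F G f g)//.
- exact: continuous_subspaceT.
- exact: has_deriv_oo_LR dF.
- by move=> x _; rewrite (has_derivE dF).
- exact: continuous_subspaceT.
- exact: has_deriv_oo_LR dG.
- by move=> x _; rewrite (has_derivE dG).
Qed.

Lemma Rintegral01_derive F f : has_deriv F f -> continuous f ->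
  \int[mu]_(x in I01) f x = F 1 - F 0.
Proof.
move=> dF cf.
have c0 : continuous (fun _ : R => 0 : R) by move=> x; exact: cvg_cst.
have := integration_by_parts01 (@has_deriv_cst 1) c0 dF cf.
have -> : (fun x => 1 * f x) = f by apply/funext => x; rewrite mul1r.
have -> : (fun x => 0 * F x) = fun=> 0 by apply/funext => x; rewrite mul0r.
by rewrite Rintegral_cst// mul0r subr0 !mul1r.
Qed.

(** An integral with a fixed lower bound [a] is differentiable at [x] only when
    [a < x]; letting the lower bound move with [x] and subtracting the integral
    up to 0 gives one primitive on the whole line. *)
Lemma continuous_primitive f : continuous f -> exists F, has_deriv F f.
Proof.
move=> cf.
have fi a b : mu.-integrable `[a, b] (EFin \o f) by exact: continuous_integrable_cc.
pose P a x := \int[mu]_(t in `[a, x]) f t.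
have Pshift a b x y : a <= b -> b <= x -> b <= y -> P a x - P a y = P b x - P b y.
  move=> ab bx by_.
  suff Q z : b <= z -> P a z = P a b + P b z by rewrite (Q x)// (Q y)// opprD addrACA subrr add0r.
  move=> bz; apply/eqP; rewrite addrC -subr_eq; apply/eqP.
  rewrite /P Rintegral_itvB ?bnd_simp//.
  rewrite Rintegral_itv_obnd_cbnd//.
  by apply: integrableS (fi b z) => //; apply: subset_itvr; rewrite bnd_simp.
exists (fun x => P (- `|x| - 1) x - P (- `|x| - 1) 0) => x.
pose a := - `|x| - 2.
(* Near [x] the moving bound can be replaced by the fixed bound [a]. *)
have Px : is_derive x (1 : R) (fun y => P a y - P a 0) (f x).
  have [||d1 d2] := @continuous_FTC1_closed _ f a x (x + 1) _ (fi _ _) _ (cf x).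
  - by rewrite ltrDl.
  - by rewrite /a; have := ler_norm (- x); rewrite normrN; lra.
  rewrite derive1E in d2.
  rewrite -[f x]subr0; apply: is_deriveB.
  by apply: DeriveDef.
apply: near_eq_is_derive Px; near=> y; apply: Pshift.
- rewrite /a; suff : `|y| <= `|x| + 1 by lra.
  have : `|y - x| < 1 by near: y; apply/nbhs_ballP; exists 1 => //= z; rewrite /ball/= distrC.
  by have := ler_normD (y - x) x; rewrite subrK; lra.
- by have := ler_norm (- y); rewrite normrN; lra.
- by have := normr_ge0 y; lra.
Unshelve. all: by end_near. Qed.

End Calculus.

(** * Smooth functions *)

Section Smooth.
Context {R : realType}.
Implicit Types (f g h u F G : R -> R) (a b c d x y : R).

Definition smooth f := forall k x, derivable (f^`(k))%classic x 1.

(** Recursing on the first derivative, rather than iterating [derive1] as [smooth]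
    does, makes the product and chain rules plain inductions. *)
Fixpoint times_derivable k f : Prop :=
  if k is k'.+1 then (forall x, derivable f x 1) /\ times_derivable k' f^`()
  else True.

Lemma smooth_times_derivable f : smooth f <-> forall k, times_derivable k f.
Proof.
split=> [sf k|].
  elim: k f sf => //= k IH f sf; split; first exact: (sf 0%N).
  by apply: IH => j x; rewrite -derive1Sn; exact: sf.
move=> tf k; elim: k f tf => [|k IH] f tf x.
  by rewrite derive1n0; have /= [] := tf 1%N.
by rewrite derive1Sn; apply: IH => j; have /= [] := tf j.+1.
Qed.

Lemma times_derivable_intro k f g : has_deriv f g -> times_derivable k g ->
  times_derivable k.+1 f.
Proof.
by move=> fg kg; split; [move=> x; exact: has_deriv_derivable fg|rewrite (has_derivE fg)].
Qed.

Lemma times_derivableW k f : times_derivable k.+1 f -> times_derivable k f.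
Proof. by elim: k f => // k IH f [df] /IH. Qed.

Lemma times_derivableD k f g : times_derivable k f -> times_derivable k g ->
  times_derivable k (fun x => f x + g x).
Proof.
elim: k f g => // k IH f g [/has_derivP df kf] [/has_derivP dg kg].
exact: times_derivable_intro (has_derivD df dg) (IH _ _ kf kg).
Qed.

Lemma times_derivableM k f g : times_derivable k f -> times_derivable k g ->
  times_derivable k (fun x => f x * g x).
Proof.
elim: k f g => // k IH f g kf kg.
have [kf' kg'] := (times_derivableW kf, times_derivableW kg).
move: kf kg => [/has_derivP df kf] [/has_derivP dg kg].
by apply: times_derivable_intro (has_derivM df dg) _; apply: times_derivableD; exact: IH.
Qed.

Lemma times_derivable_affine k a b f : times_derivable k f ->
  times_derivable k (fun x => f (a * x + b)).
Proof.
have tc j c : times_derivable j (fun=> c).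
  by elim: j c => // j IH c; exact: times_derivable_intro (has_deriv_cst c) _.
elim: k f => // k IH f [/has_derivP df kf].
apply: times_derivable_intro (has_deriv_affine a b df) _.
by apply: times_derivableM => //; exact: IH.
Qed.

Lemma smooth_has_deriv f : smooth f -> has_deriv f f^`().
Proof. by move=> sf; apply: has_derivP; exact: (sf 0%N). Qed.

Lemma smooth_derive1n f k : smooth f -> smooth (f^`(k))%classic.
Proof.
move=> sf j x; have -> : ((f^`(k))^`(j) = f^`(k + j))%classic; last exact: sf.
by elim: j => [|j IH]; rewrite ?addn0// addnS !derive1nS IH.
Qed.

Lemma smooth_derive1 f : smooth f -> smooth f^`().
Proof. exact: (@smooth_derive1n f 1). Qed.

Lemma smooth_continuous f : smooth f -> continuous f.
Proof. by move/smooth_has_deriv/has_deriv_continuous. Qed.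

Lemma smooth_primitive F f : has_deriv F f -> smooth f -> smooth F.
Proof.
move=> dF sf [|k] x; first by rewrite derive1n0; exact: has_deriv_derivable dF.
by rewrite derive1Sn (has_derivE dF); exact: sf.
Qed.

Lemma smooth_cst c : smooth (fun=> c).
Proof.
apply/smooth_times_derivable => k; elim: k c => // k IH c.
exact: times_derivable_intro (has_deriv_cst c) _.
Qed.

Lemma smooth_id : smooth (fun x => x).
Proof. by apply: smooth_primitive; [exact: has_deriv_id|exact: smooth_cst]. Qed.

Lemma smoothD f g : smooth f -> smooth g -> smooth (fun x => f x + g x).
Proof.
move=> /smooth_times_derivable sf /smooth_times_derivable sg.
by apply/smooth_times_derivable => k; exact: times_derivableD.
Qed.

Lemma smoothM f g : smooth f -> smooth g -> smooth (fun x => f x * g x).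
Proof.
move=> /smooth_times_derivable sf /smooth_times_derivable sg.
by apply/smooth_times_derivable => k; exact: times_derivableM.
Qed.

Lemma smoothZ c f : smooth f -> smooth (fun x => c * f x).
Proof. by move=> sf; exact: (smoothM (@smooth_cst c) sf). Qed.

Lemma smoothB f g : smooth f -> smooth g -> smooth (fun x => f x - g x).
Proof.
move=> sf sg; have := smoothD sf (@smoothZ (-1) _ sg).
by congr smooth; apply/funext => x; rewrite mulN1r.
Qed.

Lemma smooth_affine a b f : smooth f -> smooth (fun x => f (a * x + b)).
Proof.
move=> /smooth_times_derivable sf.
by apply/smooth_times_derivable => k; exact: times_derivable_affine.
Qed.

(** [flat 0] is the classical smooth function [exp(-1/t)] vanishing on the
    negative half-line; the powers of [1/t] make the family stable under
    differentiation, up to linear combinations. *)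
Definition flat n (t : R) : R := if 0 < t then t^-1 ^+ n * expR (- t^-1) else 0.

Lemma flat_ge0 n t : 0 <= flat n t.
Proof.
rewrite /flat; case: ifPn => // t0.
by rewrite mulr_ge0 ?expR_ge0// exprn_ge0// invr_ge0 ltW.
Qed.

Lemma flat_le0 n t : t <= 0 -> flat n t = 0.
Proof. by move=> t0; rewrite /flat ltNge t0. Qed.

(** The exponential of [1/t] dominates all its powers; this is what makes the
    one-sided powers and derivatives vanish at 0. *)
Lemma flat_le n t : flat n t <= (n.+1)`!%:R * `|t|.
Proof.
rewrite /flat; case: ifPn => [t0|_]; last by rewrite mulr_ge0.
have s0 : 0 < t^-1 by rewrite invr_gt0.
have h := expR_ge1Dxn n (ltW s0).
have f0 : 0 < (n.+1)`!%:R :> R by rewrite ltr0n fact_gt0.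
have {}h : t^-1 ^+ n.+1 <= (n.+1)`!%:R * expR t^-1.
  by rewrite -ler_pdivrMl// mulrC; apply: le_trans h; rewrite lerDr.
rewrite expRN gtr0_norm// ler_pdivrMr ?expR_gt0//.
by rewrite mulrAC -ler_pdivrMr// -exprSr.
Qed.

Lemma flat_divr n t : t^-1 * flat n t = flat n.+1 t.
Proof. by rewrite /flat; case: ifPn; rewrite ?mulr0// exprS mulrA. Qed.

Lemma flat_has_deriv n :
  has_deriv (flat n) (fun t => flat n.+2 t - n%:R * flat n.+1 t).
Proof.
move=> t; have [t0|t0|->] := ltgtP t 0.
- rewrite !flat_le0 ?ltW// mulr0 subr0.
  apply: near_eq_is_derive (@has_deriv_cst R 0 t).
  near=> y; rewrite flat_le0// ltW//; near: y; exact: lt_nbhsl.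
- have dV : is_derive t (1 : R) (fun y => y^-1) (- t ^- 2).
    have := @is_deriveV _ (fun y => y) t 1 1 (lt0r_neq0 t0) (has_deriv_id t).
    by move/is_derive_subst; apply; rewrite /GRing.scale/= mulr1.
  have dX : is_derive t (1 : R) (fun y => y^-1 ^+ n) (n%:R * t^-1 ^+ n.-1 * - t ^- 2).
    have := is_deriveX n dV; rewrite exprfctE.
    by move/is_derive_subst; apply.
  have dE : is_derive t (1 : R) (fun y => expR (- y^-1)) (expR (- t^-1) * t ^- 2).
    have dVN := is_deriveN dV.
    have := @is_derive1_comp _ expR (fun y => - y^-1) t _ _ (is_derive_expR (- t^-1)) dVN.
    by move/is_derive_subst; apply; rewrite opprK.
  have := is_deriveM dX dE.
  move/is_derive_subst => /(_ (flat n.+2 t - n%:R * flat n.+1 t)) h.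
  apply: near_eq_is_derive (h _); last first.
    rewrite /flat t0 /GRing.scale/= -exprVn.
    case: n {dX h} => [|n]; first by rewrite expr0; ring.
    by rewrite /= !exprS; ring.
  near=> y; rewrite /flat ifT//; near: y; exact: lt_nbhsr.
- rewrite !flat_le0// mulr0 subr0.
  (* The difference quotient of [flat n] at 0 is [flat n.+1] itself. *)
  have cv : h^-1 *: ((flat n \o shift 0) (h *: 1) - flat n 0) @[h --> 0^'] --> (0 : R).
    have -> : (fun h : R => h^-1 *: ((flat n \o shift 0) (h *: 1) - flat n 0)) =
              flat n.+1.
      apply/funext => h /=; rewrite addr0 [flat n 0]flat_le0// subr0.
      by rewrite /GRing.scale/= mulr1 flat_divr.
    suff cn : flat n.+1 h @[h --> (0 : R)] --> (0 : R).
      by apply: cvg_trans cn; apply: cvg_app; exact: cvg_within.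
    apply/cvgr0Pnorm_le => e e0; near=> x.
    rewrite ger0_norm ?flat_ge0//; apply: le_trans (flat_le _ _) _.
    rewrite -ler_pdivlMl ?ltr0n ?fact_gt0//; near: x.
    by apply: (@nbhs0_le _ R^o); rewrite mulr_gt0// invr_gt0 ltr0n fact_gt0.
  by apply: DeriveDef; [apply/cvg_ex; exists 0|exact: cvg_lim].
Unshelve. all: by end_near. Qed.

Lemma flat_smooth n : smooth (flat n).
Proof.
apply/smooth_times_derivable => k; elim: k n => // k IH n.
apply: times_derivable_intro (flat_has_deriv n) _.
have -> : (fun t => flat n.+2 t - n%:R * flat n.+1 t) =
          (fun t => flat n.+2 t + (- n%:R) * flat n.+1 t).
  by apply/funext => t; rewrite mulNr.
apply: times_derivableD => //; apply: times_derivableM => //.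
exact: (smooth_times_derivable (fun=> - n%:R)).1 (@smooth_cst _) k.
Qed.

Lemma test_function_intro f c d : smooth f -> 0 < c -> d < 1 ->
  (forall x, f x != 0 -> c <= x <= d) -> test_function f.
Proof.
move=> sf c0 d1 fcd.
have sub : closure [set x | f x != 0] `<=` `[c, d].
  rewrite closureE => x; apply; split; first exact: interval_closed.
  by move=> y /= /fcd; rewrite in_itv.
split => //.
- apply: (subclosed_compact _ (@segment_compact _ c d)) => //.
  exact: closed_closure.
- move=> x /sub /=; rewrite !in_itv/= => /andP[cx xd].
  by rewrite (lt_le_trans c0 cx) (le_lt_trans xd d1).
Qed.

(** The closed support is compact, so it stays at a positive distance from the
    boundary. *)
Lemma test_function_support f : test_function f -> exists c d,
  [/\ 0 < c, c < d, d < 1 & forall x, f x != 0 -> c <= x <= d].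
Proof.
move=> [_ cK K01]; set K := closure _ in cK K01.
have subK x : f x != 0 -> K x by move=> fx; apply: subset_closure.
have [K0|/set0P[x0 Kx0]] := eqVneq K set0.
  exists 3^-1, 2^-1; split; [lra|lra|lra|].
  by move=> x /subK; rewrite K0 => -[].
have ci : {within K, continuous (@id R)} by apply: continuous_subspaceT => x; exact: cvg_id.
have [d Kd dK] := @compact_EVT_max _ _ (@id R) K (ex_intro _ x0 Kx0) cK ci.
have [c Kc Kc'] := @compact_EVT_min _ _ (@id R) K (ex_intro _ x0 Kx0) cK ci.
have := K01 _ (set_mem Kd); have := K01 _ (set_mem Kc); rewrite /= !in_itv/=.
move=> /andP[c0 c1] /andP[d0 d1].
(* [d] itself could equal [c] when the support is a single point. *)
exists c, ((d + 1) / 2); split => //.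
- have := dK c Kc; lra.
- lra.
- move=> x /subK /mem_set Kx; rewrite Kc'//=; have := dK x Kx; lra.
Qed.

Lemma test_function_smooth f : test_function f -> smooth f.
Proof. by case. Qed.

End Smooth.

(** * Test functions on the unit interval *)

Section TestFunctions.
Context {R : realType}.
Implicit Types (f g h u phi psi : R -> R) (a b c d x y : R).

Local Notation mu := (@lebesgue_measure R).
Local Notation I01 := (`]0, 1[ : set R).
Local Notation integrable01 h := (mu.-integrable I01 (EFin \o h)).

(** Outside the interval that carries [phi] the function is locally zero, so its
    derivative vanishes there as well. *)
Lemma test_function_derive1 phi : test_function phi -> test_function phi^`().
Proof.
move=> tphi; have [c [d [c0 cd d1 cdphi]]] := test_function_support tphi.
have sphi := test_function_smooth tphi.
apply: (test_function_intro (smooth_derive1 sphi) c0 d1) => x.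
apply: contra_neqT => xcd.
have out : \forall y \near x, 0 = phi y.
  have phi0 y : ~~ (c <= y <= d) -> 0 = phi y.
    by move=> ycd; apply/esym; apply: contraNeq ycd => /cdphi.
  move: xcd; rewrite negb_and -!ltNge => /orP[xc|dx].
  - near=> y; apply: phi0; rewrite negb_and -!ltNge; apply/orP; left.
    by near: y; exact: lt_nbhsl.
  - near=> y; apply: phi0; rewrite negb_and -!ltNge; apply/orP; right.
    by near: y; exact: lt_nbhsr.
rewrite derive1E.
by have [] := near_eq_is_derive out (@has_deriv_cst R 0 x).
Unshelve. all: by end_near. Qed.

Lemma test_function0 phi : test_function phi -> phi 0 = 0.
Proof.
move=> /test_function_support[c [d [c0 _ _ cdphi]]].
by apply/eqP; apply: contraT => /cdphi; rewrite leNgt c0.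
Qed.

Lemma test_function1 phi : test_function phi -> phi 1 = 0.
Proof.
move=> /test_function_support[c [d [_ _ d1 cdphi]]].
by apply/eqP; apply: contraT => /cdphi; rewrite [1 <= d]leNgt d1 andbF.
Qed.

Lemma test_functionB c phi psi : test_function phi -> test_function psi ->
  test_function (fun x => phi x - c * psi x).
Proof.
move=> tphi tpsi.
have [a [b [a0 ab b1 abphi]]] := test_function_support tphi.
have [a' [b' [a0' ab' b1' abpsi]]] := test_function_support tpsi.
apply: (@test_function_intro _ _ (Num.min a a') (Num.max b b')).
- apply: smoothB; first exact: test_function_smooth.
  by apply: smoothZ; exact: test_function_smooth.
- by rewrite lt_min a0.
- by rewrite gt_max b1.
- move=> x; apply: contraTT => xab.
  have phi0 : phi x = 0.
    apply/eqP; apply: contraNT xab => /abphi/andP[ax xb].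
    by rewrite ge_min ax le_max xb.
  have psi0 : psi x = 0.
    apply/eqP; apply: contraNT xab => /abpsi/andP[ax xb].
    by rewrite ge_min ax le_max xb !orbT.
  by rewrite phi0 psi0 mulr0 subr0 eqxx.
Qed.

Lemma Rintegral_derive1_test u phi : smooth u -> test_function phi ->
  \int[mu]_(x in I01) (u x * (phi^`())%classic x) =
  - \int[mu]_(x in I01) ((u^`())%classic x * phi x).
Proof.
move=> su tphi; have sphi := test_function_smooth tphi.
rewrite (integration_by_parts01 (smooth_has_deriv su) _ (smooth_has_deriv sphi)).
- by rewrite (test_function0 tphi) (test_function1 tphi) !mulr0 subrr sub0r.
- exact/smooth_continuous/smooth_derive1.
- exact/smooth_continuous/smooth_derive1.
Qed.

(** Classical derivatives are weak derivatives: the boundary terms vanish together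
    with the test function. *)
Lemma Rintegral_derive1n_test k u phi : smooth u -> test_function phi ->
  \int[mu]_(x in I01) (u x * (phi^`(k))%classic x) =
  (-1) ^+ k * \int[mu]_(x in I01) ((u^`(k))%classic x * phi x).
Proof.
move=> su; elim: k phi => [|k IH] phi tphi; first by rewrite mul1r !derive1n0.
rewrite derive1Sn IH; last exact: test_function_derive1.
rewrite Rintegral_derive1_test//; last exact: smooth_derive1n.
by rewrite exprSr mulrN1 mulrN mulNr derive1nS.
Qed.

(** The primitive vanishing at 0 also vanishes at 1 exactly because the mean of
    [psi] is zero; being constant off the support of [psi], it is supported in
    the same interval. *)
Lemma test_function_primitive psi : test_function psi ->
  \int[mu]_(x in I01) psi x = 0 ->
  exists2 phi, test_function phi & phi^`() = psi.
Proof.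
move=> tpsi psi0; have spsi := test_function_smooth tpsi.
have [c [d [c0 cd d1 cdpsi]]] := test_function_support tpsi.
have [F dF] := continuous_primitive (smooth_continuous spsi).
pose phi x := F x - F 0.
have dphi : has_deriv phi psi.
  have := has_derivB dF (@has_deriv_cst R (F 0)).
  by congr has_deriv; apply/funext => x; rewrite subr0.
have phi0 : phi 0 = 0 by rewrite /phi subrr.
have phi1 : phi 1 = 0.
  by rewrite /phi -(Rintegral01_derive dF (smooth_continuous spsi)).
have sphi : smooth phi := smooth_primitive dphi spsi.
have phi_cst a b : a < b -> (forall x, a < x < b -> psi x = 0) -> phi a = phi b.
  move=> ab psiab; have [x xab] := MVT ab (fun x _ => dphi x)
    (continuous_subspaceT (smooth_continuous sphi)).
  rewrite psiab ?mul0r; last by rewrite in_itv/= in xab.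
  by move/eqP; rewrite subr_eq0 => /eqP.
exists phi; last exact: has_derivE.
have psi0' x : ~~ (c <= x <= d) -> psi x = 0.
  by move=> xcd; apply: contraNeq xcd => /cdpsi.
apply: (test_function_intro sphi c0 d1) => x; apply: contraTT.
rewrite negb_and -!ltNge => /orP[xc|dx]; rewrite negbK; apply/eqP.
- have [x0|x0|->//] := ltgtP x 0; rewrite -phi0; [|apply/esym];
    by apply: phi_cst => // y /andP[y1 y2]; apply: psi0'; rewrite negb_and -!ltNge; lra.
- have [x0|x0|->//] := ltgtP x 1; rewrite -phi1; [|apply/esym];
    by apply: phi_cst => // y /andP[y1 y2]; apply: psi0'; rewrite negb_and -!ltNge; lra.
Qed.

End TestFunctions.

(** * The lemma of du Bois-Reymond *)

Section DuBoisReymond.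
Context {R : realType}.
Implicit Types (f g h u phi psi : R -> R) (a b c d x y : R).

Local Notation mu := (@lebesgue_measure R).
Local Notation I01 := (`]0, 1[ : set R).
Local Notation integrable01 h := (mu.-integrable I01 (EFin \o h)).

Lemma measurable_I01 : measurable (I01 : set (measurableTypeR R)).
Proof. exact: measurable_itv. Qed.

Lemma integrable01D f g : integrable01 f -> integrable01 g ->
  integrable01 (fun x => f x + g x).
Proof.
move=> fi gi; have := integrableD measurable_I01 fi gi.
by apply: eq_integrable => // x _ /=; rewrite EFinD.
Qed.

Lemma integrable01B f g : integrable01 f -> integrable01 g ->
  integrable01 (fun x => f x - g x).
Proof.
move=> fi gi; have := integrableB measurable_I01 fi gi.
by apply: eq_integrable => // x _ /=; rewrite EFinB.
Qed.

Lemma continuous_measurable01 f : continuous f -> measurable_fun I01 f.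
Proof. by move=> cf; apply: measurable_funTS; exact: continuous_measurable_fun. Qed.

Lemma continuous_bounded01 f : continuous f ->
  exists2 M, 0 <= M & forall x, I01 x -> `|f x| <= M.
Proof.
move=> cf.
have [|z _ zM] := @EVT_max R (fun x => `|f x|) 0 1 ler01.
  apply: continuous_subspaceT => x; apply: continuous_comp; first exact: cf.
  exact: norm_continuous.
by exists `|f z| => // x x01; apply: zM; exact: subset_itv_oo_cc x01.
Qed.

Lemma integrable01M h f : integrable01 h -> continuous f ->
  integrable01 (fun x => h x * f x).
Proof.
move=> hi cf; have [M M0 fM] := continuous_bounded01 cf.
have := @integrableMl _ _ _ mu I01 measurable_I01 (EFin \o h) f hi.
apply; first exact: continuous_measurable01.
exists M; split; first exact: num_real.
by move=> N MN x x01; apply: le_trans (fM _ x01) (ltW MN).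
Qed.

Lemma Rdominated_cvg01 (f_ : nat -> R -> R) f g :
  (forall n, measurable_fun I01 (f_ n)) -> integrable01 f -> integrable01 g ->
  (forall n x, I01 x -> `|f_ n x| <= g x) ->
  (forall x, I01 x -> f_ n x @[n --> \oo] --> f x) ->
  (\int[mu]_(x in I01) f_ n x) @[n --> \oo] --> \int[mu]_(x in I01) f x.
Proof.
move=> mf fi gi fg ff; apply: fine_cvg.
rewrite fineK; last exact: integrable_fin_num.
apply: (@dominated_cvg _ _ _ mu I01 measurable_I01 (fun n => EFin \o f_ n) (EFin \o f)
  (EFin \o g)) => //.
- by move=> n; apply/measurable_EFinP; exact: mf.
- by move=> x x01; apply: cvg_EFin; [exact: nearW|exact: ff].
Qed.

Lemma invr_cvgy0 : t^-1 @[t --> +oo] --> (0 : R).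
Proof. by apply/(gtr0_cvgV0 (f := id)); [exact: nbhs_pinfty_gt|exact: cvg_id]. Qed.

Lemma flat0_cvg : flat 0 t @[t --> +oo] --> (1 : R).
Proof.
apply: (@squeeze_cvgr _ _ _ _ (fun t => 1 - t^-1) (fun=> 1)).
- near=> t; have t0 : 0 < t by near: t; exact: nbhs_pinfty_gt.
  rewrite /flat t0 expr0 mul1r; apply/andP; split; first exact: expR_ge1Dx.
  by rewrite /= expR_le1 oppr_le0 invr_ge0 ltW.
- rewrite -[X in _ --> X]subr0; apply: cvgB; first exact: cvg_cst.
  exact: invr_cvgy0.
- exact: cvg_cst.
Unshelve. all: by end_near. Qed.

Lemma flat1_cvg : flat 1 t @[t --> +oo] --> (0 : R).
Proof.
apply: (@squeeze_cvgr _ _ _ _ (fun=> 0) (fun t => t^-1)).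
- near=> t; have t0 : 0 < t by near: t; exact: nbhs_pinfty_gt.
  have V0 : 0 <= t^-1 by rewrite invr_ge0 ltW.
  apply/andP; split; first exact: flat_ge0.
  by rewrite /flat t0 expr1 ler_piMr// expR_le1 oppr_le0.
- exact: cvg_cst.
- exact: invr_cvgy0.
Unshelve. all: by end_near. Qed.

Lemma affine_cvgy a b : 0 < a -> n.+1%:R * a + b @[n --> \oo] --> +oo.
Proof.
move=> a0; apply/cvgryPge => A; near=> n.
rewrite -lerBlDr -ler_pdivrMr//.
apply: (@le_trans _ _ n%:R); last by rewrite ler_nat.
by near: n; exact: nbhs_infty_ger.
Unshelve. all: by end_near. Qed.

(** As [n] grows, [cutoff b n] tends to the indicator function of ]0, b[. *)
Definition cutoff b n x : R := flat 0 (n.+1%:R * x - 1) * flat 0 (n.+1%:R * (b - x)).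

Lemma test_function_cutoff b n : b < 1 -> test_function (cutoff b n).
Proof.
move=> b1; apply: (@test_function_intro _ _ (n.+1%:R^-1) b).
- apply: smoothM; first exact: smooth_affine (@flat_smooth R 0).
  have := @smooth_affine R (- n.+1%:R) (n.+1%:R * b) _ (@flat_smooth R 0).
  by congr smooth; apply/funext => x; congr flat; rewrite mulrBr mulNr addrC.
- by rewrite invr_gt0.
- by [].
- move=> x; apply: contraTT; rewrite negb_and -!ltNge negbK => /orP[xc|bx].
  + rewrite /cutoff flat_le0 ?mul0r// subr_le0 mulrC -ler_pdivlMr//.
    by rewrite div1r ltW.
  + by rewrite /cutoff [flat 0 (_ * (b - x))]flat_le0 ?mulr0// pmulr_rle0// subr_le0 ltW.
Qed.

Lemma flat0_le1 t : flat 0 t <= 1 :> R.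
Proof.
rewrite /flat; case: ifPn => // t0.
by rewrite expr0 mul1r expR_le1 oppr_le0 invr_ge0 ltW.
Qed.

Lemma cutoff_le1 b n x : `|cutoff b n x| <= 1.
Proof.
by rewrite normrM !ger0_norm ?flat_ge0// mulr_ile1 ?flat_ge0 ?flat0_le1.
Qed.

Lemma cutoff_cvg b x : 0 < x -> cutoff b n x @[n --> \oo] --> ((x < b)%R%:R : R).
Proof.
move=> x0; have [xb|bx] := ltP x b.
  rewrite -[1%:R]mulr1; apply: cvgM.
    exact: (cvg_comp _ _ (@affine_cvgy x (-1) x0) flat0_cvg).
  have bx : 0 < b - x by rewrite subr_gt0.
  apply: (cvg_comp _ _ _ flat0_cvg).
  by have := @affine_cvgy _ 0 bx; under eq_fun do rewrite addr0.
rewrite (_ : (fun n => cutoff b n x) = fun=> 0); first exact: cvg_cst.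
apply/funext => n; rewrite /cutoff [flat 0 (_ * (b - x))]flat_le0 ?mulr0//.
by rewrite pmulr_rle0// subr_le0.
Qed.

(** Dominated convergence along the functions [cutoff b n]. *)
Lemma integral_itv_eq0 h b : integrable01 h -> b < 1 ->
  (forall phi, test_function phi -> \int[mu]_(x in I01) (h x * phi x) = 0) ->
  \int[mu]_(x in I01) (h x * (x < b)%R%:R) = 0.
Proof.
move=> hi b1 h0.
have mlt : measurable_fun I01 (fun x => (x < b)%R%:R : R).
  have -> : (fun x => (x < b)%R%:R : R) = \1_(`]-oo, b[%classic).
    by apply/funext => x; rewrite indicE mem_setE in_itv.
  exact: measurable_indic.
have mh : measurable_fun I01 h.
  apply/measurable_EFinP; exact: (measurable_int mu hi).
suff : \int[mu]_(x in I01) (h x * cutoff b n x) @[n --> \oo] -->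
       \int[mu]_(x in I01) (h x * (x < b)%R%:R).
  rewrite (_ : (fun n => _) = fun=> 0).
    by move/(cvg_lim (@Rhausdorff R)) => <-; rewrite lim_cst.
  by apply/funext => n; apply: h0; exact: test_function_cutoff.
apply: (@Rdominated_cvg01 _ _ (fun x => `|h x|)).
- move=> n; apply: measurable_funM => //.
  apply: continuous_measurable01; apply: smooth_continuous.
  by apply: test_function_smooth; exact: test_function_cutoff.
- apply: le_integrable hi => //.
    by apply/measurable_EFinP; apply: measurable_funM.
  move=> x _ /=; rewrite lee_fin normrM ler_piMr// normr_nat.
  by case: (x < b); rewrite ?lexx ?ler01.
- exact: integrable_norm.
- by move=> n x _; rewrite normrM ler_piMr// cutoff_le1.
- move=> x; rewrite /= in_itv/= => /andP[x0 _].
  by apply: cvgM; [exact: cvg_cst|exact: cutoff_cvg].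
Qed.

(** The indefinite integral of [h] vanishes, as seen by approximating indicator
    functions, and by Lebesgue's theorem [h] is almost everywhere its
    derivative. *)
Lemma ae_eq0_test h : integrable01 h ->
  (forall phi, test_function phi -> \int[mu]_(x in I01) (h x * phi x) = 0) ->
  {ae mu, forall x, I01 x -> h x = 0}.
Proof.
move=> hi h0; pose H := h \_ I01.
have Hi : mu.-integrable [set: R] (EFin \o H).
  by rewrite -restrict_EFin; apply/(integrable_mkcond _ measurable_I01).
have Hiy y : mu.-integrable `]-oo, y] (EFin \o H) by exact: integrableS Hi.
pose F y := \int[mu]_(x in `]-oo, y]) H x.
have : {ae mu, forall x, derivable F x 1 /\ F^`() x = H x}.
  exact: FTC1Ny Hiy (integrable_locally measurable_I01 hi).
have F0 y : y < 1 -> F y = 0.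
  move=> y1; rewrite /F -Rintegral_itv_bndo_bndc; last exact: integrableS Hi.
  rewrite Rintegral_mkcond -[RHS](integral_itv_eq0 hi y1 h0) [RHS]Rintegral_mkcond.
  apply: eq_Rintegral => x _; rewrite /H !patchE !mem_setE !in_itv/=.
  by case: (x < y); case: ifP; rewrite ?mulr1 ?mulr0.
apply: filterS; first exact: (ae_filter_ringOfSetsType mu).
move=> x + x01; have := x01; rewrite /= in_itv/= => /andP[x0 x1].
rewrite derive1E => -[_].
have nF : \forall y \near x, 0 = F y.
  by near=> y; rewrite F0//; near: y; exact: lt_nbhsl.
have [_ ->] := near_eq_is_derive nF (@has_deriv_cst R 0 x).
by rewrite /H patchE mem_set.
Unshelve. all: by end_near. Qed.

End DuBoisReymond.

Section VanishingDerivatives.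
Context {R : realType}.
Implicit Types (f g h u phi psi : R -> R) (a b c d x y : R).

Local Notation mu := (@lebesgue_measure R).
Local Notation I01 := (`]0, 1[ : set R).
Local Notation integrable01 h := (mu.-integrable I01 (EFin \o h)).

Lemma ae01_impl (P Q : R -> Prop) : (forall x, I01 x -> P x -> Q x) ->
  {ae mu, forall x, I01 x -> P x} -> {ae mu, forall x, I01 x -> Q x}.
Proof.
move=> PQ; apply: filterS; first exact: (ae_filter_ringOfSetsType mu).
by move=> x Px x01; apply: PQ => //; exact: Px.
Qed.

(** Intervals have positive measure, so no exceptional set contains one. *)
Lemma ae01_witness (P : R -> Prop) a b : 0 <= a -> a < b -> b <= 1 ->
  {ae mu, forall x, I01 x -> P x} -> exists x, a < x < b /\ P x.
Proof.
move=> a0 ab b1 [N [mN N0 PN]]; apply: contrapT => noP.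
have abN : `]a, b[ `<=` N.
  move=> x; rewrite /= in_itv/= => xab; apply: PN => /= Px; apply: noP.
  exists x; split=> //; apply: Px; rewrite in_itv/=; move: xab => /andP[ax xb].
  by rewrite (le_lt_trans a0 ax) (lt_le_trans xb b1).
have : (mu `]a, b[ <= mu N)%E by apply: le_measure => //; rewrite inE//; exact: measurable_itv.
rewrite N0 lebesgue_measure_itv/= lte_fin ab -EFinB lee_fin subr_le0.
by rewrite leNgt ab.
Qed.

(** Functions that are continuous on [0, 1] and differ at a point differ on an
    interval. *)
Lemma ae01_continuous_eq u f : {within `[0, 1], continuous u} -> continuous f ->
  {ae mu, forall x, I01 x -> u x = f x} -> forall x, `[0, 1] x -> u x = f x.
Proof.
move=> cu cf uf x x01; apply: contrapT => /eqP; rewrite -subr_eq0 => uf0.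
have cx : (u y - f y) @[y --> within `[0, 1] (nbhs x)] --> u x - f x.
  apply: cvgB; last exact: cvg_within_filter (cf x).
  by move/subspace_continuousP : cu; exact.
have /nbhs_ballP[e /= e0 xe] : \forall y \near x, `[0, 1] y -> u y - f y != 0.
  exact: (cvgr_neq0 _ cx uf0).
move: x01; rewrite /= in_itv/= => /andP[x0 x1].
have [|||y [/andP[y1 y2] uy]] := @ae01_witness _ (Num.max 0 (x - e)) (Num.min 1 (x + e)) _ _ _ uf.
- by rewrite le_max lexx.
- by rewrite gt_max !lt_min; apply/andP; split; apply/andP; split; lra.
- by rewrite ge_min lexx.
move: y1 y2; rewrite gt_max lt_min => /andP[y0 ey] /andP[y1' ye].
have : ball x e y by rewrite /ball/= ltr_distlC; lra.
move=> /xe; rewrite /= in_itv/= !ltW// => /(_ isT).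
by rewrite uy subrr eqxx.
Qed.

Lemma test_function_integrable phi : test_function phi -> integrable01 phi.
Proof.
move=> tphi; apply: continuous_integrable01; apply: smooth_continuous.
exact: test_function_smooth.
Qed.

(** If all test functions had mean zero, the constant 1 would vanish almost
    everywhere. *)
Lemma test_function_mean1 : exists2 psi : R -> R,
  test_function psi & \int[mu]_(x in I01) psi x = 1.
Proof.
have [psi tpsi psi0] : exists2 psi : R -> R, test_function psi &
    \int[mu]_(x in I01) psi x != 0.
  apply: contrapT => no.
  have i1 : integrable01 (fun=> 1).
    by apply: continuous_integrable01 => x; exact: cvg_cst.
  have := @ae_eq0_test R (fun=> 1) i1.
  have h0 psi : test_function psi -> \int[mu]_(x in I01) (1 * psi x) = 0.
    move=> tpsi; under eq_Rintegral do rewrite mul1r.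
    by apply/eqP; apply: contrapT => /negP psi0; apply: no; exists psi.
  move=> /(_ h0) /(@ae01_witness _ 0 1 (lexx 0) ltr01 (lexx 1))[x [_ /eqP]].
  by rewrite oner_eq0.
exists (fun x => 0 - - (\int[mu]_(x in I01) psi x)^-1 * psi x).
  apply: test_functionB tpsi; apply: (@test_function_intro _ _ 3^-1 2^-1).
  - exact: smooth_cst.
  - lra.
  - lra.
  - by move=> x; rewrite eqxx.
under eq_Rintegral do rewrite sub0r -mulNr opprK.
by rewrite RintegralZl ?mulVf//; exact: test_function_integrable.
Qed.

(** A test function of mean zero is the derivative of a test function, so a
    functional killing all derivatives only sees the mean. *)
Lemma functional_of_mean (T : (R -> R) -> R) :
  (forall c phi psi, test_function phi -> test_function psi ->
    T (fun x => phi x - c * psi x) = T phi - c * T psi) ->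
  (forall phi, test_function phi -> T phi^`() = 0) ->
  exists C, forall psi, test_function psi -> T psi = C * \int[mu]_(x in I01) psi x.
Proof.
move=> Tlin T0; have [psi1 tpsi1 psi11] := test_function_mean1.
exists (T psi1) => psi tpsi; set c := \int[mu]_(x in I01) psi x.
have [|phi tphi phiE] := test_function_primitive (test_functionB c tpsi tpsi1).
  have i1 := test_function_integrable tpsi1.
  rewrite RintegralB ?RintegralZl ?psi11 ?mulr1 ?subrr//.
    exact: test_function_integrable.
  apply: continuous_integrable01; apply: smooth_continuous; apply: smoothZ.
  exact: test_function_smooth.
by have := T0 _ tphi; rewrite phiE Tlin// => /eqP; rewrite subr_eq0 mulrC => /eqP.
Qed.

Lemma smooth_derive1B c f g : smooth f -> smooth g ->
  ((fun x => f x - c * g x)^`())%classic = fun x => (f^`())%classic x - c * (g^`())%classic x.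
Proof.
move=> /smooth_has_deriv df /smooth_has_deriv dg; apply: has_derivE.
by apply: has_derivB => //; exact: has_derivZ.
Qed.

Lemma Rintegral_test_linear h c phi psi : integrable01 h ->
  continuous phi -> continuous psi ->
  \int[mu]_(x in I01) (h x * (phi x - c * psi x)) =
  \int[mu]_(x in I01) (h x * phi x) - c * \int[mu]_(x in I01) (h x * psi x).
Proof.
move=> hi cphi cpsi.
have i1 := integrable01M hi cphi; have i2 := integrable01M hi cpsi.
rewrite -RintegralZl// -RintegralB//; last first.
  by have := integrableZl (@measurable_I01 R) c i2; apply: eq_integrable.
by apply: eq_Rintegral => x _; rewrite mulrBr mulrCA.
Qed.

(** The functional [phi |-> int h phi'] kills derivatives, so it is
    [C int phi = - int C x phi'].  Hence [phi |-> int (h + C x) phi] kills derivatives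
    in turn, and is [D int phi]; then [h + C x - D] vanishes against all test
    functions. *)
Lemma ae_affine_test2 h : integrable01 h ->
  (forall phi, test_function phi ->
    \int[mu]_(x in I01) (h x * (phi^`(2))%classic x) = 0) ->
  exists a b, {ae mu, forall x, I01 x -> h x = a + b * x}.
Proof.
move=> hi h0.
have cT phi : test_function phi -> continuous phi.
  by move=> tphi; apply: smooth_continuous; exact: test_function_smooth.
have cid c : continuous (fun x => c * x).
  by apply: smooth_continuous; apply: smoothZ; exact: smooth_id.
have [C hC] : exists C, forall phi, test_function phi ->
    \int[mu]_(x in I01) (h x * (phi^`())%classic x) = C * \int[mu]_(x in I01) phi x.
  apply: (@functional_of_mean (fun phi => \int[mu]_(x in I01) (h x * (phi^`())%classic x))).
    move=> c phi psi tphi tpsi; rewrite smooth_derive1B; try exact: test_function_smooth.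
    by rewrite Rintegral_test_linear//; apply: cT; exact: test_function_derive1.
  by move=> phi tphi; have := h0 _ tphi; rewrite derive1nS derive1n1.
pose k x := h x + C * x.
have ki : integrable01 k.
  by apply: integrable01D => //; exact: continuous_integrable01.
have [D kD] : exists D, forall phi, test_function phi ->
    \int[mu]_(x in I01) (k x * phi x) = D * \int[mu]_(x in I01) phi x.
  apply: (@functional_of_mean (fun phi => \int[mu]_(x in I01) (k x * phi x))).
    by move=> c phi psi tphi tpsi; rewrite Rintegral_test_linear//; exact: cT.
  move=> phi tphi; have c' := cT _ (test_function_derive1 tphi).
  rewrite (_ : \int[mu]_(x in I01) _ =
    \int[mu]_(x in I01) (h x * (phi^`())%classic x) +
    \int[mu]_(x in I01) (C * x * (phi^`())%classic x)); last first.
    rewrite -RintegralD//.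
    - by apply: eq_Rintegral => x _; rewrite mulrDl.
    - exact: integrable01M.
    - by apply: integrable01M => //; exact: continuous_integrable01.
  rewrite hC// Rintegral_derive1_test//; last by apply: smoothZ; exact: smooth_id.
  rewrite (has_derivE (has_derivZ C (@has_deriv_id R))).
  by rewrite RintegralZl ?mulr1 ?subrr//; exact: test_function_integrable.
exists D, (- C).
have cD : continuous (fun _ : R => D) by move=> x; exact: cvg_cst.
have kDi : integrable01 (fun x => k x - D).
  by apply: integrable01B => //; exact: continuous_integrable01.
apply: ae01_impl (ae_eq0_test kDi _) => [x _ /eqP|phi tphi].
  by rewrite subr_eq0 /k => /eqP <-; rewrite mulNr addrK.
have cphi := cT _ tphi.
rewrite (_ : \int[mu]_(x in I01) _ =
  \int[mu]_(x in I01) (k x * phi x) - \int[mu]_(x in I01) (D * phi x)); last first.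
  rewrite -RintegralB//.
  - by apply: eq_Rintegral => x _; rewrite mulrBl.
  - exact: integrable01M.
  - by apply: integrable01M => //; exact: continuous_integrable01.
by rewrite kD// RintegralZl ?subrr//; exact: test_function_integrable.
Qed.

End VanishingDerivatives.

(** * Powers *)

Section Powers.
Context {R : realType}.
Implicit Types (s t x e : R).

Lemma pos_powR_continuous s : 0 < s -> continuous (fun t => Num.max t 0 `^ s).
Proof.
move=> s0 x; have [x0|x0|->] := ltgtP x 0.
- rewrite /continuous_at max_r ?ltW//.
  have h : (fun _ : R => 0 `^ s) y @[y --> x] --> 0 `^ s by exact: cvg_cst.
  apply: cvg_trans h; apply: near_eq_cvg; near=> y; rewrite max_r// ltW//; near: y; exact: lt_nbhsl.
- rewrite /continuous_at max_l ?ltW//.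
  have h : y `^ s @[y --> x] --> x `^ s.
    have : {for x, continuous (fun y => y `^ s)}; last by [].
    apply: differentiable_continuous; apply/derivable1_diffP.
    by apply: derivable_powR; rewrite in_itv/= x0.
  apply: cvg_trans h; apply: near_eq_cvg; near=> y.
  by rewrite max_l// ltW//; near: y; exact: lt_nbhsr.
- rewrite /continuous_at maxxx powR0 ?gt_eqF//.
  apply/cvgr0Pnorm_lt => e e0.
  have d0 : 0 < e `^ s^-1 by rewrite powR_gt0.
  near=> y; rewrite ger0_norm ?powR_ge0//.
  have -> : e = (e `^ s^-1) `^ s by rewrite -powRrM mulVf ?gt_eqF// powRr1// ltW.
  apply: gt0_ltr_powR; rewrite ?nnegrE ?le_max ?lexx ?orbT ?powR_ge0//.
  rewrite gt_max d0 andbT; near: y; exact: lt_nbhsl.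
Unshelve. all: by end_near. Qed.

Lemma norm_powR_continuous s : 0 < s -> continuous (fun t => `|t| `^ s).
Proof.
move=> s0 x.
have -> : (fun t => `|t| `^ s) = (fun t => Num.max t 0 `^ s) \o Num.norm.
  by apply/funext => t /=; rewrite max_l.
by apply: continuous_comp; [exact: norm_continuous|exact: pos_powR_continuous].
Qed.

Lemma norm_signed_pow s t : 0 < s -> `|signed_pow s t| = `|t| `^ s.
Proof.
move=> s0; rewrite /signed_pow normrM (ger0_norm (powR_ge0 _ _)) mulrC.
by rewrite mulr_powRB1.
Qed.

Lemma signed_pow_pos s t : 0 < s -> 0 <= t -> signed_pow s t = t `^ s.
Proof. by move=> s0 t0; rewrite /signed_pow ger0_norm// mulrC mulr_powRB1. Qed.

Lemma signed_powN s t : signed_pow s (- t) = - signed_pow s t.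
Proof. by rewrite /signed_pow normrN mulrN. Qed.

(** As a difference of powers of the positive and negative parts, since the factor
    [|t|^(s-1)] of the definition is unbounded near 0 when [s < 1]. *)
Lemma signed_pow_continuous s : 0 < s -> continuous (signed_pow s).
Proof.
move=> s0.
have -> : signed_pow s = fun t => Num.max t 0 `^ s - Num.max (- t) 0 `^ s.
  apply/funext => t; case/orP: (le_total 0 t) => t0.
    rewrite signed_pow_pos// max_l// max_r ?oppr_le0//.
    by rewrite powR0 ?gt_eqF// subr0.
  rewrite -[t in LHS]opprK signed_powN signed_pow_pos ?oppr_ge0//.
  by rewrite max_r// max_l ?oppr_ge0// powR0 ?gt_eqF// sub0r.
move=> x; apply: cvgB; first exact: pos_powR_continuous.
apply: (@continuous_comp _ _ _ -%R (fun t => Num.max t 0 `^ s)).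
  exact: opp_continuous.
exact: pos_powR_continuous.
Qed.

Lemma signed_powK s t : 0 < s -> signed_pow s^-1 (signed_pow s t) = t.
Proof.
move=> s0; have [->|t0] := eqVneq t 0; first by rewrite /signed_pow !mulr0.
rewrite {1}/signed_pow norm_signed_pow// /signed_pow mulrA -powRrM -powRD; last first.
  by rewrite normr_eq0 t0 implybT.
rewrite mulrBr mulfV ?gt_eqF// mulr1 (_ : 1 - s + (s - 1) = 0) ?powRr0 ?mul1r//.
by rewrite addrC subrKA subrr.
Qed.

End Powers.

(** * Sobolev functions on the unit interval *)

Section Sobolev.
Context {R : realType}.
Implicit Types (f g h u phi psi rho : R -> R) (a b c d e x y m : R).

Local Notation mu := (@lebesgue_measure R).
Local Notation I01 := (`]0, 1[ : set R).
Local Notation integrable01 h := (mu.-integrable I01 (EFin \o h)).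

Lemma measure_I01 : mu I01 = 1%E.
Proof. by rewrite lebesgue_measure_itv/= lte_fin ltr01 -EFinB subr0. Qed.

Lemma restrict01_measurable u :
  measurable_fun I01 u <-> measurable_fun [set: R] (u \_ I01).
Proof. exact: measurable_restrictT. Qed.

Lemma Lnorm01E m u : 0 < m ->
  Lnorm01 m u = ((\int[mu]_(x in I01) (`|u x| `^ m)%:E) `^ m^-1)%E.
Proof.
move=> m0; rewrite /Lnorm01 unlock [in RHS]integral_mkcond; congr (_ `^ _)%E.
apply: eq_integral => x _; rewrite /= !patchE.
by case: ifPn => //= _; rewrite normr0 powR0 ?gt_eqF.
Qed.

Lemma Lnorm01_cst1 m : 0 < m -> Lnorm01 m (fun=> 1 : R) = 1%E.
Proof.
move=> m0; rewrite Lnorm01E//; under eq_integral do rewrite normr1 powR1.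
by rewrite integral_cst//= measure_I01 mule1 poweR1r.
Qed.

(** Hoelder's inequality against the constant 1, whose norms on an interval of
    length 1 are all 1. *)
Lemma Lnorm01_le1 m h : 1 < m -> measurable_fun I01 h ->
  (\int[mu]_(x in I01) `|h x|%:E <= Lnorm01 m h)%E.
Proof.
move=> m1 mh; have m0 : 0 < m by lra.
pose m' := (1 - m^-1)^-1.
have mV1 : m^-1 < 1 by rewrite invf_lt1.
have m'0 : 0 < m' by rewrite invr_gt0 subr_gt0.
pose one : R -> R := fun=> 1.
have := @hoelder _ _ _ mu (h \_ I01) (one \_ I01) m m' _ _ m0 m'0.
have -> : ('N[mu]_m'%:E[EFin \o (one \_ I01)])%E = Lnorm01 m' (fun=> 1) by [].
rewrite Lnorm01_cst1// mule1 => H; apply: (le_trans _ (H _ _ _)); last first.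
- by rewrite /m' invrK addrC subrK.
- by apply/restrict01_measurable; exact: measurable_cst.
- exact/restrict01_measurable.
rewrite Lnorm1 [leLHS]integral_mkcond le_eqVlt; apply/orP; left; apply/eqP.
apply: eq_integral => x _; rewrite /= !patchE.
by case: ifPn => //= _; rewrite ?mulr1// mulr0 normr0.
Qed.

Lemma Lfun01_measurable m u : Lfun01 m u -> measurable_fun I01 u.
Proof.
by move=> /sub_Lfun_mfun; rewrite inE/= => /restrict01_measurable.
Qed.

Lemma Lfun01_powR_integrable m u : 1 <= m -> Lfun01 m u ->
  integrable01 (fun x => `|u x| `^ m).
Proof.
move=> m1 /(Lfun_integrable m1).
move=> /(integrableS measurableT (@measurable_I01 R) (@subsetT _ _)).
apply: eq_integrable => // x x01.
by rewrite /= patchE x01.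
Qed.

Lemma powR_le1D s m x : 0 <= s -> s <= m -> 0 <= x -> x `^ s <= 1 + x `^ m.
Proof.
move=> s0 sm x0; have [x1|x1] := leP x 1.
  have [->|xn0] := eqVneq x 0.
    have [->|sn0] := eqVneq s 0; first by rewrite powRr0 lerDl powR_ge0.
    by rewrite powR0// addr_ge0// powR_ge0.
  apply: (@le_trans _ _ 1); last by rewrite lerDl powR_ge0.
  by rewrite -(powRr0 x) ger_powR// lt0r xn0 x0.
apply: (@le_trans _ _ (x `^ m)); last by rewrite lerDr.
exact: (ler_powR (ltW x1)).
Qed.

(** On a set of finite measure it is enough to dominate by [1 + |u|^m]. *)
Lemma integrable01_le_powR m s u h : 1 <= m -> 0 <= s -> s <= m -> Lfun01 m u ->
  measurable_fun I01 h -> (forall x, `|h x| = `|u x| `^ s) -> integrable01 h.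
Proof.
move=> m1 s0 sm um mh hu.
have i1 : integrable01 (fun=> 1).
  by apply: continuous_integrable01 => x; exact: cvg_cst.
have := integrable01D i1 (Lfun01_powR_integrable m1 um).
apply: le_integrable => //; first exact/measurable_EFinP.
by move=> x _; rewrite /= lee_fin hu [leRHS]ger0_norm ?powR_le1D.
Qed.

Lemma Lfun01_integrable m u : 1 <= m -> Lfun01 m u -> integrable01 u.
Proof.
move=> m1 um; apply: (integrable01_le_powR m1 ler01 m1 um).
  exact: Lfun01_measurable um.
by move=> x; rewrite powRr1.
Qed.

Lemma continuous_Lfun01 m u : 0 < m -> continuous u -> Lfun01 m u.
Proof.
move=> m0 cu; apply/andP; split; rewrite inE/=.
  by apply/restrict01_measurable; exact: continuous_measurable01.
rewrite /finite_norm -/(Lnorm01 m u) Lnorm01E//; apply: poweR_lty.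
have /integrableP[_] : integrable01 (fun x => `|u x| `^ m).
  apply: continuous_integrable01 => x.
  apply: (@continuous_comp _ _ _ u (fun t => `|t| `^ m)); first exact: cu.
  exact: norm_powR_continuous.
by under eq_integral do rewrite /= ger0_norm ?powR_ge0//.
Qed.

(** Dominated convergence applied to the functions [|h_n|^m]. *)
Lemma Lnorm01_bounded_cvg m (h : nat -> R -> R) (M : R) : 0 < m ->
  (forall n, measurable_fun I01 (h n)) ->
  (forall n x, I01 x -> `|h n x| <= M) ->
  (forall x, I01 x -> h n x @[n --> \oo] --> (0 : R)) ->
  forall e, 0 < e -> \forall n \near \oo, (Lnorm01 m (h n) < e%:E)%E.
Proof.
move=> m0 mh hM h0 e e0.
have cc c : continuous (fun _ : R => c) by move=> x; exact: cvg_cst.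
have mp n : measurable_fun I01 (fun x => `|h n x| `^ m).
  apply: (@measurableT_comp _ _ _ _ _ _ (@powR R ^~ m)) => //.
  exact: measurableT_comp.
have hMm n x : I01 x -> `|h n x| `^ m <= M `^ m.
  move=> x01; have hx := hM n _ x01.
  by apply: (ge0_ler_powR (ltW m0)); rewrite ?nnegrE// (le_trans _ hx).
have : \int[mu]_(x in I01) (`|h n x| `^ m) @[n --> \oo] --> \int[mu]_(x in I01) 0.
  apply: (@Rdominated_cvg01 _ _ (fun=> 0) (fun=> M `^ m)) => //.
  - exact: continuous_integrable01.
  - exact: continuous_integrable01.
  - by move=> n x x01; rewrite ger0_norm ?powR_ge0// hMm.
  - move=> x x01; have := @norm_powR_continuous R m m0 0.
    rewrite /continuous_at normr0 powR0 ?gt_eqF// => c0.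
    exact: (cvg_comp _ _ (h0 _ x01) c0).
rewrite Rintegral_cst// mul0r => h0'.
have em0 : 0 < e `^ m by rewrite powR_gt0.
have lt_em := cvgr_lt _ h0' _ em0; near=> n.
have hn : \int[mu]_(x in I01) (`|h n x| `^ m) < e `^ m.
  by near: n; exact: lt_em.
have hi : integrable01 (fun x => `|h n x| `^ m).
  apply: (le_integrable (@measurable_I01 R) _ _ (continuous_integrable01 (cc (M `^ m)))).
    by apply/measurable_EFinP; exact: mp.
  move=> x x01; rewrite /= lee_fin ger0_norm ?powR_ge0// (le_trans (hMm n _ x01))//.
  exact: ler_norm.
rewrite Lnorm01E// -[X in (X `^ _)%E]fineK; last exact: integrable_fin_num hi.
rewrite poweR_EFin lte_fin.
have -> : e = (e `^ m) `^ m^-1 by rewrite -powRrM mulfV ?gt_eqF// powRr1// ltW.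
apply: gt0_ltr_powR; rewrite ?invr_gt0// nnegrE ?powR_ge0//.
by apply: fine_ge0; apply: integral_ge0 => x _; rewrite lee_fin powR_ge0.
Unshelve. all: by end_near. Qed.

Lemma smooth_weak_derivative m k u : 0 < m -> smooth u ->
  weak_derivative m k u (u^`(k))%classic.
Proof.
move=> m0 su; split; last by move=> phi tphi; exact: Rintegral_derive1n_test.
by apply: continuous_Lfun01 => //; apply: smooth_continuous; exact: smooth_derive1n.
Qed.

Lemma smooth_sobolev m k u : 0 < m -> smooth u -> sobolev k m u.
Proof.
move=> m0 su; split; first by apply: continuous_Lfun01 => //; exact: smooth_continuous.
by move=> j _; exists (u^`(j))%classic; exact: smooth_weak_derivative.
Qed.

Lemma test_function_X q phi : 0 < q -> test_function phi -> X q phi.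
Proof.
move=> q0 tphi; have sphi := test_function_smooth tphi.
have m0 : 0 < (q + 1) / q by rewrite divr_gt0// addr_gt0.
split; first by apply: continuous_subspaceT; exact: smooth_continuous.
  exact: smooth_sobolev.
split; first by apply: continuous_Lfun01 => //; exact: smooth_continuous.
exists (phi^`(1))%classic; first exact: smooth_weak_derivative.
move=> e e0; exists phi => //; rewrite derive1n1.
have N0 f : (Lnorm01 ((q + 1) / q) (f \- f)%R = 0)%E.
  rewrite Lnorm01E//; under eq_integral do rewrite /= subrr normr0 powR0 ?gt_eqF//.
  by rewrite integral0 poweR0r// invr_neq0// gt_eqF.
by rewrite !N0 adde0 lte_fin.
Qed.

End Sobolev.

(** * Boundary values *)

Section BoundaryValues.
Context {R : realType}.
Implicit Types (f g h u v phi psi rho : R -> R) (a b c d e x y m q : R).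

Local Notation mu := (@lebesgue_measure R).
Local Notation I01 := (`]0, 1[ : set R).
Local Notation integrable01 h := (mu.-integrable I01 (EFin \o h)).

(** Smooth approximations, vanishing near 0, of the identity of [0, +oo[: their
    derivatives are bounded and tend to 1 pointwise. *)
Definition ramp n x : R := (x - n.+1%:R^-1) * flat 0 (n.+1%:R * x - 1).

Definition ramp' n x : R := flat 0 (n.+1%:R * x - 1) + flat 1 (n.+1%:R * x - 1).

Lemma ramp_has_deriv n : has_deriv (ramp n) (ramp' n).
Proof.
have d1 := has_derivB (@has_deriv_id R) (@has_deriv_cst R n.+1%:R^-1).
have d2 := has_deriv_affine n.+1%:R (- 1) (@flat_has_deriv R 0).
have := has_derivM d1 d2; congr has_deriv; apply/funext => x.
rewrite subr0 mul1r mul0r subr0 /ramp'; congr (_ + _).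
set t := n.+1%:R * x - 1.
rewrite mulrA [(x - _) * _]mulrC mulrBr mulfV// -/t.
have [->|t0] := eqVneq t 0; first by rewrite mul0r flat_le0.
(* The two terms combine because [t * flat 2 t = flat 1 t]. *)
by rewrite -flat_divr mulrA mulfV// mul1r.
Qed.

Lemma ramp_smooth n : smooth (ramp n).
Proof.
apply: smoothM; first by apply: smoothB; [exact: smooth_id|exact: smooth_cst].
exact: (smooth_affine (@flat_smooth R 0)).
Qed.

Lemma ramp_le1 n x : I01 x -> `|ramp n x| <= 1.
Proof.
rewrite /= in_itv/= => /andP[x0 x1].
rewrite normrM mulr_ile1//; last by rewrite ger0_norm ?flat_ge0 ?flat0_le1.
have N0 : 0 < n.+1%:R^-1 :> R by rewrite invr_gt0.
have N1 : n.+1%:R^-1 <= 1 :> R by rewrite invf_le1// ler1n.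
move: N0 N1; move: n.+1%:R^-1 => c c0 c1.
by rewrite ler_norml; apply/andP; split; lra.
Qed.

Lemma flat1_le1 t : flat 1 t <= 1 :> R.
Proof.
rewrite /flat; case: ifPn => // t0.
rewrite expr1 expRN ler_pdivrMr ?expR_gt0// mul1r.
by apply: le_trans (expR_ge1Dx _); rewrite lerDr.
Qed.

Lemma ramp'_le2 n x : `|ramp' n x| <= 2.
Proof.
rewrite ger0_norm ?addr_ge0 ?flat_ge0//.
by rewrite (_ : 2 = 1 + 1)// lerD ?flat0_le1 ?flat1_le1.
Qed.

Lemma ramp_cvg x : 0 < x -> ramp n x @[n --> \oo] --> x.
Proof.
move=> x0; rewrite -[X in _ --> X]mulr1; apply: cvgM.
  rewrite -[X in _ --> X]subr0; apply: cvgB; first exact: cvg_cst.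
  exact: cvg_harmonic.
exact: (cvg_comp _ _ (@affine_cvgy R x (-1) x0) flat0_cvg).
Qed.

Lemma ramp'_cvg x : 0 < x -> ramp' n x @[n --> \oo] --> (1 : R).
Proof.
move=> x0; rewrite -[X in _ --> X]addr0; apply: cvgD.
  exact: (cvg_comp _ _ (@affine_cvgy R x (-1) x0) flat0_cvg).
exact: (cvg_comp _ _ (@affine_cvgy R x (-1) x0) flat1_cvg).
Qed.

Lemma ramp_eq0 n x : x <= n.+1%:R^-1 -> ramp n x = 0.
Proof.
move=> xN; rewrite /ramp flat_le0 ?mulr0// subr_le0 mulrC.
by rewrite -ler_pdivlMr// div1r.
Qed.

(** The smooth functions vanishing at 0 and 1, written with their zeros factored
    out so that each factor can be replaced by a ramp. *)
Definition smooth_dirichlet rho x : R := x * (1 - x) * rho x.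

Definition smooth_dirichlet' rho x : R :=
  (1 - x - x) * rho x + x * (1 - x) * (rho^`())%classic x.

Lemma smooth_dirichlet_has_deriv rho : smooth rho ->
  has_deriv (smooth_dirichlet rho) (smooth_dirichlet' rho).
Proof.
move=> srho.
have d1 := has_derivB (@has_deriv_cst R 1) (@has_deriv_id R).
have := has_derivM (has_derivM (@has_deriv_id R) d1) (smooth_has_deriv srho).
congr has_deriv; apply/funext => x.
by rewrite sub0r mul1r mulrN mulr1.
Qed.

Lemma smooth_dirichlet_smooth rho : smooth rho -> smooth (smooth_dirichlet rho).
Proof.
move=> srho; apply: smoothM => //; apply: smoothM; first exact: smooth_id.
by apply: smoothB; [exact: smooth_cst|exact: smooth_id].
Qed.

Let approx n rho x : R := ramp n x * ramp n (1 - x) * rho x.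

Let approx' n rho x : R :=
  (ramp' n x * ramp n (1 - x) - ramp n x * ramp' n (1 - x)) * rho x +
  ramp n x * ramp n (1 - x) * (rho^`())%classic x.

Let ramp_sym_has_deriv n : has_deriv (fun x => ramp n (1 - x)) (fun x => - ramp' n (1 - x)).
Proof.
have := has_deriv_affine (- 1) 1 (ramp_has_deriv n).
have e x : - 1 * x + 1 = 1 - x by rewrite mulN1r addrC.
by congr has_deriv; apply/funext => x; rewrite e ?mulN1r.
Qed.

Let approx_has_deriv n rho : smooth rho -> has_deriv (approx n rho) (approx' n rho).
Proof.
move=> srho.
have := has_derivM (has_derivM (ramp_has_deriv n) (ramp_sym_has_deriv n))
  (smooth_has_deriv srho).
by congr has_deriv; apply/funext => x; rewrite /approx' mulrN.
Qed.

Let approx_smooth n rho : smooth rho -> smooth (approx n rho).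
Proof.
move=> srho; apply: smoothM => //; apply: smoothM; first exact: ramp_smooth.
have := @smooth_affine R (-1) 1 _ (@ramp_smooth n).
by congr smooth; apply/funext => x; rewrite mulN1r addrC.
Qed.

Let approx_test n rho : smooth rho -> test_function (approx n rho).
Proof.
move=> srho.
apply: (@test_function_intro _ _ n.+1%:R^-1 (1 - n.+1%:R^-1)).
- exact: approx_smooth.
- by rewrite invr_gt0.
- by rewrite ltrBlDr ltrDl invr_gt0.
- move=> x; apply: contraTT; rewrite negb_and -!ltNge negbK /approx => /orP[xc|dx].
    by rewrite ramp_eq0 ?mul0r// ltW.
  rewrite [ramp n (1 - x)]ramp_eq0 ?mulr0 ?mul0r//.
  by move: dx; move: n.+1%:R^-1 => c; lra.
Qed.

(** Replacing [x] and [1 - x] by ramps gives test functions that converge, together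
    with their derivatives, pointwise and boundedly, hence in every L^m. *)
Lemma smooth_dirichlet_sobolev0 m rho : 0 < m -> smooth rho ->
  sobolev0 m (smooth_dirichlet rho).
Proof.
move=> m0 srho; have sU := smooth_dirichlet_smooth srho.
have dU := smooth_dirichlet_has_deriv srho.
split; first by apply: continuous_Lfun01 => //; exact: smooth_continuous.
exists ((smooth_dirichlet rho)^`(1))%classic; first exact: smooth_weak_derivative.
rewrite derive1n1 (has_derivE dU) => e e0.
have e2 : 0 < e / 2 by rewrite divr_gt0.
have sU' : smooth (smooth_dirichlet' rho).
  by rewrite -(has_derivE dU); exact: smooth_derive1.
have [M0 M0_ge0 rhoM] := continuous_bounded01 (smooth_continuous srho).
have [M1 M1_ge0 rhoM'] := continuous_bounded01 (smooth_continuous (smooth_derive1 srho)).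
have [M2 M2_ge0 UM] := continuous_bounded01 (smooth_continuous sU).
have [M3 M3_ge0 UM'] := continuous_bounded01 (smooth_continuous sU').
have sym x : I01 x -> I01 (1 - x).
  by rewrite /= !in_itv/= => /andP[x0 x1]; rewrite subr_gt0 x1 ltrBlDr ltrDl.
have ramp2_le1 n x : I01 x -> `|ramp n x * ramp n (1 - x)| <= 1.
  by move=> x01; rewrite normrM mulr_ile1// ramp_le1//; exact: sym.
have n1 : \forall n \near \oo,
    (Lnorm01 m (smooth_dirichlet rho \- approx n rho)%R < (e / 2)%:E)%E.
  apply: (@Lnorm01_bounded_cvg _ _ _ (M2 + M0)) => //.
  - move=> n; apply: continuous_measurable01; apply: smooth_continuous.
    by apply: smoothB => //; exact: approx_smooth.
  - move=> n x x01; apply: le_trans (ler_normB _ _) _.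
    apply: lerD; first exact: UM.
    rewrite /approx normrM -[M0]mul1r.
    by apply: ler_pM => //; [exact: ramp2_le1|exact: rhoM].
  - move=> x; rewrite /= in_itv/= => /andP[x0 x1].
    have x1' : 0 < 1 - x by rewrite subr_gt0.
    rewrite -[X in _ --> X](subrr (smooth_dirichlet rho x)).
    apply: cvgB; first exact: cvg_cst.
    apply: cvgM; last exact: cvg_cst.
    by apply: cvgM; exact: ramp_cvg.
have n2 : \forall n \near \oo,
    (Lnorm01 m (smooth_dirichlet' rho \- approx' n rho)%R < (e / 2)%:E)%E.
  apply: (@Lnorm01_bounded_cvg _ _ _ (M3 + (4 * M0 + M1))) => //.
  - move=> n; apply: continuous_measurable01; apply: smooth_continuous.
    apply: smoothB => //; rewrite -(has_derivE (@approx_has_deriv n _ srho)).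
    by apply: smooth_derive1; exact: approx_smooth.
  - move=> n x x01; apply: le_trans (ler_normB _ _) _.
    apply: lerD; first exact: UM'.
    apply: le_trans (ler_normD _ _) _; apply: lerD; rewrite normrM.
      apply: ler_pM => //; last exact: rhoM.
      apply: le_trans (ler_normB _ _) _; rewrite (_ : 4 = 2 * 1 + 1 * 2); last by ring.
      have r1 := ramp_le1 n x01; have r2 := ramp_le1 n (sym _ x01).
      have [r3 r4] := (ramp'_le2 n x, ramp'_le2 n (1 - x)).
      by apply: lerD; rewrite normrM; apply: ler_pM.
    by rewrite -[M1]mul1r; apply: ler_pM => //; [exact: ramp2_le1|exact: rhoM'].
  - move=> x; rewrite /= in_itv/= => /andP[x0 x1].
    have x1' : 0 < 1 - x by rewrite subr_gt0.
    rewrite -[X in _ --> X](subrr (smooth_dirichlet' rho x)).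
    apply: cvgB; first exact: cvg_cst.
    apply: cvgD; (apply: cvgM; last exact: cvg_cst).
      rewrite -[X in _ --> X - _]mul1r -[X in _ --> _ - X]mulr1.
      by apply: cvgB; apply: cvgM; by [exact: ramp_cvg|exact: ramp'_cvg].
    by apply: cvgM; exact: ramp_cvg.
near \oo => n; exists (approx n rho); first exact: approx_test.
rewrite (has_derivE (@approx_has_deriv n _ srho)) (splitr e) EFinD.
by apply: lteD; near: n.
Unshelve. all: by end_near. Qed.

Lemma smooth_dirichlet_X q rho : 0 < q -> smooth rho -> X q (smooth_dirichlet rho).
Proof.
move=> q0 srho; have sU := smooth_dirichlet_smooth srho.
have m0 : 0 < (q + 1) / q by rewrite divr_gt0// addr_gt0.
split.
- by apply: continuous_subspaceT; exact: smooth_continuous.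
- exact: smooth_sobolev.
- exact: smooth_dirichlet_sobolev0.
Qed.

(** Integration by parts without boundary terms passes from test functions to
    their limits; against affine functions it forces both boundary values to
    vanish. *)
Lemma sobolev0_boundary m v V V1 : 1 < m -> sobolev0 m v ->
  has_deriv V V1 -> continuous V1 -> (forall x, I01 x -> v x = V x) ->
  V 0 = 0 /\ V 1 = 0.
Proof.
move=> m1 [vm [g [gm gw] vapprox]] dV cV1 vV; have m1' := ltW m1.
have cV := has_deriv_continuous dV.
have gi := Lfun01_integrable m1' gm; have vi := Lfun01_integrable m1' vm.
have mv := Lfun01_measurable vm; have mg := Lfun01_measurable gm.
have gV1 : {ae mu, forall x, I01 x -> g x - V1 x = 0}.
  apply: ae_eq0_test; first by apply: integrable01B => //; exact: continuous_integrable01.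
  move=> phi tphi; have sphi := test_function_smooth tphi.
  have cphi := smooth_continuous sphi.
  have -> : \int[mu]_(x in I01) ((g x - V1 x) * phi x) =
      \int[mu]_(x in I01) (g x * phi x) - \int[mu]_(x in I01) (V1 x * phi x).
    rewrite -RintegralB//.
    - by apply: eq_Rintegral => x _; rewrite mulrBl.
    - exact: integrable01M.
    - by apply: integrable01M => //; exact: continuous_integrable01.
  have := gw _ tphi; rewrite expr1 mulN1r derive1n1 => /eqP; rewrite -eqr_oppLR => /eqP <-.
  have -> : \int[mu]_(x in I01) (v x * (phi^`())%classic x) =
            \int[mu]_(x in I01) (V x * (phi^`())%classic x).
    by apply: eq_Rintegral => x; rewrite inE => x01; rewrite vV.
  rewrite (integration_by_parts01 dV cV1 (smooth_has_deriv sphi)).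
    by rewrite (test_function0 tphi) (test_function1 tphi) !mulr0 subrr sub0r opprK subrr.
  by apply: smooth_continuous; exact: smooth_derive1.
have affine a b : V 1 * (a + b) - V 0 * a = 0.
  pose psi x := a + b * x.
  have dpsi : has_deriv psi (fun=> b).
    have := has_derivD (@has_deriv_cst R a) (has_derivZ b (@has_deriv_id R)).
    by congr has_deriv; apply/funext => x; rewrite add0r mulr1.
  have cb : continuous (fun _ : R => b) by move=> x; exact: cvg_cst.
  have cpsi := has_deriv_continuous dpsi.
  pose D := \int[mu]_(x in I01) (v x * b + g x * psi x).
  have vbi : integrable01 (fun x => v x * b) by exact: integrable01M.
  have gpi : integrable01 (fun x => g x * psi x) by exact: integrable01M.
  (* By the classical formula [D] consists of boundary terms of [V]; it vanishes
     because the same expression is zero for every test function. *)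
  have DE : D = V 1 * (a + b) - V 0 * a.
    rewrite /D RintegralD//.
    have -> : \int[mu]_(x in I01) (v x * b) = \int[mu]_(x in I01) (V x * b).
      by apply: eq_Rintegral => x; rewrite inE => x01; rewrite vV.
    have -> : \int[mu]_(x in I01) (g x * psi x) = \int[mu]_(x in I01) (V1 x * psi x).
      have V1i : integrable01 (fun x => V1 x * psi x).
        by apply: integrable01M => //; exact: continuous_integrable01.
      congr fine; apply: ae_eq_integral => //.
        exact: measurable_int gpi.
        exact: measurable_int V1i.
      apply: ae01_impl gV1 => x _ /eqP; rewrite subr_eq0 => /eqP /= ->.
      by [].
    rewrite (integration_by_parts01 dV cV1 dpsi cb) subrK /psi.
    by rewrite mulr1 mulr0 addr0.
  rewrite -DE; apply/eqP; rewrite -normr_le0; apply/ler_addgt0Pl => e e0.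
  rewrite addr0.
  have [M M0 psiM] := continuous_bounded01 cpsi.
  (* [|D| <= |b| ||v - phi||_1 + M ||g - phi'||_1], so precision [e / K] is enough;
     the summand 1 keeps [K] positive. *)
  pose K := M + `|b| + 1.
  have K0 : 0 < K by rewrite /K; have := normr_ge0 b; lra.
  have [phi tphi phie] := vapprox _ (divr_gt0 e0 K0).
  have sphi := test_function_smooth tphi; have cphi := smooth_continuous sphi.
  have cphi' := smooth_continuous (smooth_derive1 sphi).
  have vphi : integrable01 (fun x => v x - phi x).
    by apply: integrable01B => //; exact: continuous_integrable01.
  have gphi : integrable01 (fun x => g x - (phi^`())%classic x).
    by apply: integrable01B => //; exact: continuous_integrable01.
  have N1 : (\int[mu]_(x in I01) `|v x - phi x|%:E <= Lnorm01 m (v \- phi)%R)%E.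
    apply: (@Lnorm01_le1 R m (v \- phi)) => //.
    by apply/measurable_EFinP; exact: measurable_int vphi.
  have N2 : (\int[mu]_(x in I01) `|g x - (phi^`())%classic x|%:E
      <= Lnorm01 m (g \- (phi^`())%classic)%R)%E.
    apply: (@Lnorm01_le1 R m (g \- (phi^`())%classic)) => //.
    by apply/measurable_EFinP; exact: measurable_int gphi.
  pose A := \int[mu]_(x in I01) `|v x - phi x|.
  pose B := \int[mu]_(x in I01) `|g x - (phi^`())%classic x|.
  have ABe : A + B < e / K.
    rewrite -lte_fin EFinD; apply: le_lt_trans phie; rewrite /A /B /Rintegral !fineK.
    + exact: leeD.
    + exact: integrable_fin_num (integrable_norm gphi).
    + exact: integrable_fin_num (integrable_norm vphi).
  have A0 : 0 <= A by apply: Rintegral_ge0.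
  have B0 : 0 <= B by apply: Rintegral_ge0.
  have i1 : integrable01 (fun x => (v x - phi x) * b) by exact: integrable01M.
  have i2 : integrable01 (fun x => (g x - (phi^`())%classic x) * psi x).
    exact: integrable01M.
  have DE' : D = \int[mu]_(x in I01) ((v x - phi x) * b) +
                 \int[mu]_(x in I01) ((g x - (phi^`())%classic x) * psi x).
    have p1 : integrable01 (fun x => phi x * b).
      by apply: integrable01M => //; exact: continuous_integrable01.
    have p2 : integrable01 (fun x => (phi^`())%classic x * psi x).
      by apply: integrable01M => //; exact: continuous_integrable01.
    have P0 : \int[mu]_(x in I01) (phi x * b + (phi^`())%classic x * psi x) = 0.
      rewrite RintegralD//.
      rewrite (integration_by_parts01 (smooth_has_deriv sphi) cphi' dpsi cb) subrK.
      by rewrite (test_function0 tphi) (test_function1 tphi) !mul0r subrr.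
    rewrite -RintegralD//.
    transitivity (D - \int[mu]_(x in I01) (phi x * b + (phi^`())%classic x * psi x)).
      by rewrite P0 subr0.
    rewrite /D -RintegralB//; [|exact: integrable01D|exact: integrable01D].
    by apply: eq_Rintegral => x _; ring.
  rewrite DE'; apply: le_trans (ler_normD _ _) _.
  have b1 : `|\int[mu]_(x in I01) ((v x - phi x) * b)| <= A * `|b|.
    by rewrite RintegralZr// normrM ler_wpM2r// le_normr_Rintegral.
  have b2 : `|\int[mu]_(x in I01) ((g x - (phi^`())%classic x) * psi x)| <= B * M.
    apply: le_trans (le_normr_Rintegral (@measurable_I01 R) i2) _.
    have iB := integrable_norm gphi.
    have cM : continuous (fun _ : R => M) by move=> x; exact: cvg_cst.
    rewrite /B -RintegralZr//; apply: le_Rintegral => //.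
    - exact: integrable_norm i2.
    - exact: (integrable01M iB cM).
    - by move=> x x01; rewrite normrM ler_wpM2l// psiM.
  apply: le_trans (lerD b1 b2) _.
  have : (A + B) * K <= e by rewrite -ler_pdivlMr// ltW.
  apply: le_trans; rewrite /K.
  have := mulr_ge0 A0 M0; have := mulr_ge0 B0 (normr_ge0 b); lra.
(* The affine functions [x] and [1 - x]. *)
have := affine 0 1; have := affine 1 (- 1).
rewrite add0r subrr !mulr0 !mulr1 subr0 sub0r => /eqP; rewrite oppr_eq0 => /eqP.
by [].
Qed.

End BoundaryValues.

(** * Regularity of weak solutions *)

Section Regularity.
Context {R : realType}.
Implicit Types (f g h u v w phi psi rho : R -> R) (a b c d e x y m q : R).

Local Notation mu := (@lebesgue_measure R).
Local Notation I01 := (`]0, 1[ : set R).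
Local Notation integrable01 h := (mu.-integrable I01 (EFin \o h)).

Lemma ae01_eq_Rintegral f g : integrable01 f -> integrable01 g ->
  {ae mu, forall x, I01 x -> f x = g x} ->
  \int[mu]_(x in I01) f x = \int[mu]_(x in I01) g x.
Proof.
move=> fi gi fg; congr fine; apply: ae_eq_integral => //.
- exact: measurable_int fi.
- exact: measurable_int gi.
- by apply: ae01_impl fg => x _ /= ->.
Qed.

(** Precompose with the projection of the line onto [0, 1]. *)
Lemma continuous_extension01 v : {within `[0, 1], continuous v} ->
  exists2 vt, continuous vt & forall x, `[0, 1] x -> vt x = v x.
Proof.
move=> cv; pose clamp x : R := Num.max 0 (Num.min 1 x).
have clamp01 x : `[0, 1] (clamp x).
  by rewrite /= in_itv/= /clamp le_max lexx ge_max ler01 ge_min lexx.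
have cclamp : continuous clamp.
  move=> x; apply: continuous_max; first exact: cvg_cst.
  by apply: continuous_min; [exact: cvg_cst|exact: cvg_id].
exists (v \o clamp); last first.
  by move=> x; rewrite /= in_itv/= /clamp => /andP[x0 x1]; rewrite min_r// max_r.
move=> x; move/subspace_continuousP : cv => /(_ _ (clamp01 x)) cv.
move=> A /cv nA; rewrite nbhs_simpl/=.
have nA' : nbhs x [set y | `[0, 1] (clamp y) -> A (v (clamp y))] := cclamp x _ nA.
suff : nbhs x [set y | A (v (clamp y))] by [].
by apply: filterS nA' => y; exact.
Qed.

Lemma has_deriv_is_derivative_on u F f : has_deriv F f ->
  (forall x, `[0, 1] x -> u x = F x) -> is_derivative_on `[0, 1] u f.
Proof.
move=> dF uF x x01; have [] := dF x.
move=> /cvg_ex[/= l hl]; rewrite /derive (cvg_lim _ hl)// => lE.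
rewrite {l}lE in hl.
apply/cvgrPdist_lt => e e0.
move/cvgrPdist_lt : hl => /(_ _ e0) /nbhs_ballP[d /= d0 xd].
apply/nbhs_ballP; exists d => // y xy yx y01.
have yx0 : y - x != 0 by rewrite subr_eq0.
have := xd (y - x); rewrite /ball/= sub0r normrN distrC => /(_ xy yx0).
by rewrite /GRing.scale/= mulr1 subrK mulrC !uF.
Qed.

Lemma Rintegral_derive2_test F G f phi : has_deriv F G -> has_deriv G f ->
  continuous f -> test_function phi ->
  \int[mu]_(x in I01) (F x * (phi^`(2))%classic x) =
  \int[mu]_(x in I01) (f x * phi x).
Proof.
move=> dF dG cf tphi; have tphi' := test_function_derive1 tphi.
have [sphi sphi'] := (test_function_smooth tphi, test_function_smooth tphi').
have cG := has_deriv_continuous dG.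
rewrite derive1nS derive1n1.
rewrite (integration_by_parts01 dF cG (smooth_has_deriv sphi')); last first.
  by apply: smooth_continuous; exact: smooth_derive1.
rewrite (integration_by_parts01 dG cf (smooth_has_deriv sphi)); last first.
  exact: smooth_continuous.
rewrite (test_function0 tphi) (test_function1 tphi).
by rewrite (test_function0 tphi') (test_function1 tphi') !mulr0 !subrr !sub0r opprK.
Qed.

Lemma continuous_primitive2 f : continuous f ->
  exists F G, has_deriv F G /\ has_deriv G f.
Proof.
move=> cf; have [G dG] := continuous_primitive cf.
have [F dF] := continuous_primitive (has_deriv_continuous dG).
by exists F, G.
Qed.

(** Subtracting from [u] a classical double primitive of [f] leaves a function with
    vanishing weak second derivative. *)
Lemma ae_primitive2 u f : integrable01 u -> continuous f ->
  (forall phi, test_function phi ->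
    \int[mu]_(x in I01) (u x * (phi^`(2))%classic x) =
    \int[mu]_(x in I01) (f x * phi x)) ->
  exists U U1, [/\ has_deriv U U1, has_deriv U1 f &
    {ae mu, forall x, I01 x -> u x = U x}].
Proof.
move=> ui cf uf; have [F [G [dF dG]]] := continuous_primitive2 cf.
have Fi := continuous_integrable01 (has_deriv_continuous dF).
have [|a [b uab]] := ae_affine_test2 (integrable01B ui Fi).
  move=> phi tphi.
  have cphi'' : continuous (phi^`(2))%classic.
    by apply: smooth_continuous; apply: smooth_derive1n; exact: test_function_smooth.
  have := uf _ tphi; rewrite -(Rintegral_derive2_test dF dG cf tphi) => uF.
  have -> : \int[mu]_(x in I01) ((u x - F x) * (phi^`(2))%classic x) =
      \int[mu]_(x in I01) (u x * (phi^`(2))%classic x) -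
      \int[mu]_(x in I01) (F x * (phi^`(2))%classic x).
    rewrite -RintegralB//; try exact: integrable01M.
    by apply: eq_Rintegral => x _; rewrite mulrBl.
  by rewrite uF subrr.
have dab : has_deriv (fun x => a + b * x) (fun=> b).
  have := has_derivD (@has_deriv_cst R a) (has_derivZ b (@has_deriv_id R)).
  by congr has_deriv; apply/funext => x; rewrite add0r mulr1.
exists (fun x => F x + (a + b * x)), (fun x => G x + b); split.
- exact: has_derivD.
- have := has_derivD dG (@has_deriv_cst R b).
  by congr has_deriv; apply/funext => x; rewrite addr0.
- by apply: ae01_impl uab => x _ <-; rewrite addrC subrK.
Qed.

(** Integrating by parts twice, the volume terms cancel and the boundary terms
    reduce to [W 1 * rho 1 + W 0 * rho 0], as [x (1 - x) rho] vanishes at both ends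
    while its derivative is [rho 0] and [- rho 1] there; take [rho = x] and
    [rho = 1]. *)
Lemma natural_boundary w W W1 f : has_deriv W W1 -> has_deriv W1 f ->
  continuous f -> integrable01 w -> {ae mu, forall x, I01 x -> w x = W x} ->
  (forall rho, smooth rho ->
    \int[mu]_(x in I01) (w x * ((smooth_dirichlet rho)^`(2))%classic x) =
    \int[mu]_(x in I01) (f x * smooth_dirichlet rho x)) ->
  W 0 = 0 /\ W 1 = 0.
Proof.
move=> dW dW1 cf wi wW weq; have cW := has_deriv_continuous dW.
have cW1 := has_deriv_continuous dW1.
have bd rho : smooth rho -> W 1 * rho 1 + W 0 * rho 0 = 0.
  move=> srho; set phi := smooth_dirichlet rho.
  have sphi : smooth phi by exact: smooth_dirichlet_smooth.
  have dphi : has_deriv phi (smooth_dirichlet' rho) by exact: smooth_dirichlet_has_deriv.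
  have phi'E := has_derivE dphi.
  have c1 : continuous (phi^`(1))%classic.
    by apply: smooth_continuous; exact: smooth_derive1n.
  have c2 : continuous (phi^`(2))%classic.
    by apply: smooth_continuous; exact: smooth_derive1n.
  have d2 : has_deriv (smooth_dirichlet' rho) (phi^`(2))%classic.
    rewrite derive1nS derive1n1 phi'E; apply: smooth_has_deriv.
    by rewrite -phi'E; exact: smooth_derive1.
  have cphi' := has_deriv_continuous d2.
  have := weq _ srho; rewrite -/phi.
  have -> : \int[mu]_(x in I01) (w x * (phi^`(2))%classic x) =
            \int[mu]_(x in I01) (W x * (phi^`(2))%classic x).
    apply: ae01_eq_Rintegral.
    - exact: integrable01M.
    - by apply: integrable01M => //; exact: continuous_integrable01.
    - by apply: ae01_impl wW => x _ ->.
  rewrite (integration_by_parts01 dW cW1 d2 c2).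
  rewrite (integration_by_parts01 dW1 cf dphi cphi').
  have -> : phi 0 = 0 by rewrite /phi /smooth_dirichlet !mul0r.
  have -> : phi 1 = 0 by rewrite /phi /smooth_dirichlet subrr mulr0 mul0r.
  rewrite /smooth_dirichlet' subrr !sub0r !subr0 !mulr0 !mul0r !addr0 subrr sub0r opprK.
  rewrite mulN1r mul1r => /eqP; rewrite -subr_eq0 addrK mulrN -opprD oppr_eq0.
  by move/eqP.
have := bd _ smooth_id; rewrite mulr1 mulr0 addr0 => W1_0; split => //.
by have := bd _ (@smooth_cst R 1); rewrite !mulr1 W1_0 add0r.
Qed.

Lemma rhs_continuous (lambda p r : R) : 0 < p -> 0 < r -> continuous (rhs lambda p r).
Proof.
move=> p0 r0 x; apply: cvgD; last exact: pos_powR_continuous.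
by apply: cvgM; [exact: cvg_cst|exact: pos_powR_continuous].
Qed.

End Regularity.

Theorem proposition5 (R : realType) (p q r lambda : R)
  (hp : 0 < p) (hq : 0 < q) (hr : 0 < r)
  (hrq : r < q^-1) (hpq : Num.max 1 q^-1 < p) (hlambda : 0 < lambda)
  (v : R -> R) (hv : weak_solution lambda p q r v) :
  classical_solution lambda p q r v.
Proof.
have [[cv sv s0v] [v2 [v2m v2w] weq]] := hv.
set m := (q + 1) / q in sv s0v v2m v2w weq.
have q1 : 0 < q^-1 by rewrite invr_gt0.
have mE : m = 1 + q^-1 by rewrite /m mulrDl mulfV ?gt_eqF// mul1r.
have m1 : 1 < m by rewrite mE ltrDl.
have m0 : 0 < m := lt_trans ltr01 m1.
have [vt cvt vtE] := continuous_extension01 cv.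
pose f x := rhs lambda p r (vt x).
have cf : continuous f.
  move=> x; apply: (@continuous_comp _ _ _ vt (rhs lambda p r)); first exact: cvt.
  exact: rhs_continuous.
have fE x : (`]0, 1[ : set R) x -> f x = rhs lambda p r (v x).
  by move=> x01; rewrite /f vtE//; exact: subset_itv_oo_cc.
pose w x := signed_pow q^-1 (v2 x).
have mw : measurable_fun (`]0, 1[ : set R) w.
  apply: (measurableT_comp _ (Lfun01_measurable v2m)).
  by apply: continuous_measurable_fun; exact: signed_pow_continuous.
have wi : (@lebesgue_measure R).-integrable `]0, 1[ (EFin \o w).
  apply: (integrable01_le_powR (ltW m1) (ltW q1) _ v2m mw).
    by rewrite mE lerDr.
  by move=> x; rewrite norm_signed_pow.
have weqf phi phi2 : X q phi -> weak_derivative m 2 phi phi2 ->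
    \int[lebesgue_measure]_(x in `]0, 1[) (w x * phi2 x) =
    \int[lebesgue_measure]_(x in `]0, 1[) (f x * phi x).
  move=> Xphi dphi; rewrite /w (weq _ _ Xphi dphi).
  by apply: eq_Rintegral => x; rewrite inE => x01; rewrite fE.
have [W [W1 [dW dW1 wW]]] : exists W W1, [/\ has_deriv W W1, has_deriv W1 f &
    {ae lebesgue_measure, forall x, (`]0, 1[ : set R) x -> w x = W x}].
  apply: ae_primitive2 => // phi tphi; apply: weqf; first exact: test_function_X.
  by apply: smooth_weak_derivative => //; exact: test_function_smooth.
(* The natural boundary conditions need more than compactly supported tests. *)
have [W_0 W_1] : W 0 = 0 /\ W 1 = 0.
  apply: (natural_boundary dW dW1 cf wi wW) => rho srho.
  apply: weqf; first exact: smooth_dirichlet_X.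
  by apply: smooth_weak_derivative => //; exact: smooth_dirichlet_smooth.
(* Inverting the power nonlinearity gives a continuous representative of [v'']. *)
pose V2 x := signed_pow q (W x).
have cV2 : continuous V2.
  move=> x; apply: (@continuous_comp _ _ _ W (signed_pow q)).
    exact: has_deriv_continuous dW x.
  exact: signed_pow_continuous.
have v2V2 : {ae lebesgue_measure, forall x, (`]0, 1[ : set R) x -> v2 x = V2 x}.
  apply: ae01_impl wW => x _ wWx; rewrite /V2 -wWx /w.
  by have := @signed_powK R _ (v2 x) q1; rewrite invrK.
have v2i := Lfun01_integrable (ltW m1) v2m.
have vi := Lfun01_integrable (ltW m1) s0v.1.
have [V [V1 [dV dV1 vVae]]] : exists V V1, [/\ has_deriv V V1, has_deriv V1 V2 &
    {ae lebesgue_measure, forall x, (`]0, 1[ : set R) x -> v x = V x}].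
  apply: ae_primitive2 => // phi tphi.
  have cphi : continuous phi by apply: smooth_continuous; exact: test_function_smooth.
  rewrite v2w// expr2 mulrNN !mul1r; apply: ae01_eq_Rintegral.
  - exact: integrable01M.
  - by apply: integrable01M => //; exact: continuous_integrable01.
  - by apply: ae01_impl v2V2 => x _ ->.
have vV x : `[0, 1] x -> v x = V x.
  exact: ae01_continuous_eq cv (has_deriv_continuous dV) vVae x.
have [V_0 V_1] : V 0 = 0 /\ V 1 = 0.
  apply: (sobolev0_boundary m1 s0v dV (has_deriv_continuous dV1)) => x x01.
  by apply: vV; exact: subset_itv_oo_cc.
have WE : signed_pow q^-1 \o V2 = W.
  by apply/funext => x; rewrite /V2 /= signed_powK.
exists V1, V2; split; split.
- exact: has_deriv_is_derivative_on dV vV.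
- exact: has_deriv_is_derivative_on dV1 (fun _ _ => erefl).
- exact: continuous_subspaceT.
- rewrite WE; split.
    move=> [|[|//]] x _ _; first by rewrite derive1n0; exact: has_deriv_derivable dW.
    by rewrite derive1n1 (has_derivE dW); exact: has_deriv_derivable dW1.
  by move=> x _; rewrite derive1nS derive1n1 (has_derivE dW) (has_derivE dW1); exact: cf.
- move=> x; rewrite inE => x01.
  by rewrite WE derive1nS derive1n1 (has_derivE dW) (has_derivE dW1) fE.
- by rewrite !vV// /= in_itv/= ?lexx ?ler01.
- by rewrite /V2 W_0 W_1 /signed_pow !mulr0.
Qed.
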